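(* Let $n\ge1$, let $\lambda_i,\alpha_i\in\mathbb C^*$ and $h_i(t)\in\mathbb C[t]$ for $i=1,2,\ldots,n$ be such that the $\lambda_i$ are pairwise distinct and $\deg h_i(t)=1$ for all $i$. Let $V$ be an irreducible $\mathscr V$-module for which there exists $R_V\in\mathbb Z_+$ such that $L_k$ is locally finite on $V$ for every $k\geq R_V$. Then: (i) $\bigotimes_{i=1}^n\Phi(\lambda_i,\alpha_i,h_i)$ is irreducible as a $\mathscr V_r$-module for any $r\in\mathbb Z_+$; (ii) the tensor product module $\bigotimes_{i=1}^n\Phi(\lambda_i,\alpha_i,h_i)\otimes V$ is an irreducible $\mathscr V$-module; (iii) in particular, $\bigotimes_{i=1}^n\Phi(\lambda_i,\alpha_i,h_i)$ is an irreducible $\mathscr V$-module.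
   Context: $\mathbb Z_+$ is the set of nonnegative integers. $\mathscr V$ is the Virasoro algebra: the complex Lie algebra with basis $\{L_m,C\mid m\in\mathbb Z\}$ and brackets $[L_m,L_n]=(n-m)L_{m+n}+\delta_{m+n,0}\frac{m^3-m}{12}C$, $[L_m,C]=0$. For $r\in\mathbb Z_+$, $\mathscr V_r$ is the Lie subalgebra spanned by $\{L_i\mid i>r\}$. An operator is locally finite on $V$ if each vector of $V$ lies in a finite-dimensional subspace invariant under it. For $\lambda,\alpha\in\mathbb C^*$ and $h=h(t)\in\mathbb C[t]$, put $g(t)=\frac{h(t)-h(\alpha)}{t-\alpha}\in\mathbb C[t]$. Here $\Phi(\lambda,\alpha,h)$ denotes the $\mathscr V$-module (the case $b=-1$ of the paper's family) on the polynomial space $\mathbb C[s,t]$ with $C$ acting as $0$ and $$L_mf(s,t)=\lambda^m\Big(\big(s+mh(t)-m(m-1)\alpha g(t)\big)f(s-m,t)-m(t-m\alpha)\tfrac{\partial}{\partial t}f(s-m,t)\Big)$$ for $m\in\mathbb Z$, $f(s,t)\in\mathbb C[s,t]$. Tensor products carry the usual tensor product action of a Lie algebra. *)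

(* Defs.v *)
From HB Require Import structures.
From mathcomp Require Import all_boot all_order all_algebra.
From mathcomp Require Import ring_quotient boolp.
From mathcomp Require Import mpoly freeg ring zify.

Set Implicit Arguments.
Unset Strict Implicit.
Unset Printing Implicit Defensive.

Import GRing.Theory.
Local Open Scope ring_scope.
Local Open Scope quotient_scope.

Section LinearAlgebra.
Context (K : fieldType) (V : lmodType K).

Definition subspace (W : V -> Prop) : Prop :=
  W 0 /\ forall (a : K) (u v : V), W u -> W v -> W (a *: u + v).

Definition span (X : V -> Prop) (v : V) : Prop :=
  exists2 s : seq (K * V),
    (forall p, p \in s -> X p.2) & v = \sum_(p <- s) p.1 *: p.2.

Definition finite_dimensional (W : V -> Prop) : Prop :=
  exists e : seq V, forall v, W v <-> span (fun u => u \in e) v.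

Definition locally_finite (T : V -> V) : Prop :=
  forall v, exists W : V -> Prop,
    [/\ subspace W, finite_dimensional W, W v & forall u, W u -> W (T u)].

Lemma span_subspace (X : V -> Prop) : subspace (span X).
Proof.
split; first by exists [::] => //; rewrite big_nil.
move=> a _ _ [s sX ->] [t tX ->].
exists ([seq (a * p.1, p.2) | p <- s] ++ t); first move=> p.
  by rewrite mem_cat => /orP[/mapP[q qs ->]|/tX //]; exact: (sX _ qs).
rewrite big_cat big_map scaler_sumr /=; congr (_ + _).
by apply: eq_bigr => p _; rewrite scalerA.
Qed.

Lemma span_incl (X : V -> Prop) v : X v -> span X v.
Proof.
move=> Xv; exists [:: (1, v)]; last by rewrite big_seq1 scale1r.
by move=> p; rewrite inE => /eqP ->.
Qed.

Lemma span_min (X W : V -> Prop) :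
  subspace W -> (forall v, X v -> W v) -> forall v, span X v -> W v.
Proof.
move=> [W0 Wlin] XW _ [s sX ->].
elim: s sX => [|p s IHs] sX; first by rewrite big_nil.
rewrite big_cons; apply: Wlin; first by apply/XW/sX; rewrite mem_head.
by apply: IHs => q qs; apply: sX; rewrite inE qs orbT.
Qed.

End LinearAlgebra.

Section FreeModule.
Context (K : fieldType) (B : choiceType).

Lemma fglift_linear (M : lmodType K) (f : B -> M) : linear (fglift f).
Proof.
have fB := @lift_is_additive _ _ _ f.
have f0 : fglift f 0 = 0 by rewrite -(subrr 0) fB subrr.
have fN x : fglift f (- x) = - fglift f x by rewrite -[- x]sub0r fB f0 sub0r.
have fD x y : fglift f (x + y) = fglift f x + fglift f y.
  by rewrite -{1}[y]opprK fB fN opprK.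
have fS (I : Type) (r : seq I) F :
    fglift f (\sum_(i <- r) F i) = \sum_(i <- r) fglift f (F i).
  by elim/big_rec2: _ => [|i ? ? _ <-]; rewrite ?f0 ?fD.
move=> a x y; rewrite fD; congr (_ + _).
have -> : a *: x = fgscale a x by [].
rewrite -[x in RHS](freeg_sumE x) [in RHS]fS scaler_sumr /fgscale fS.
by apply: eq_bigr => b _; rewrite !liftU scalerA.
Qed.

Lemma freeg_span (W : {freeg B / K} -> Prop) :
  subspace W -> (forall b, W << b >>) -> forall x, W x.
Proof.
move=> [W0 Wlin] WU x; rewrite -(freeg_sumE x).
elim: (dom x) => [|b s IHs]; rewrite (big_nil, big_cons) //.
suff -> : << coeff b x *g b >> = coeff b x *: << b >> :> {freeg B / K}
  by apply: Wlin.
by apply/eqP/freeg_eqP => c; rewrite coeffZ !coeffU mul1r.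
Qed.

Lemma fglift_ext (M : lmodType K) (f g : B -> M) :
  f =1 g -> fglift f =1 fglift g.
Proof.
move=> fg; apply: freeg_span => [|b]; last by rewrite !liftU fg.
split=> [|a u v hu hv]; last by rewrite !fglift_linear hu hv.
by rewrite -(subrr 0) !lift_is_additive !subrr.
Qed.

Lemma fglift_linearr (M N : lmodType K) (f : B -> M -> N) :
  (forall b, linear (f b)) -> forall x, linear (fun m => fglift (f^~ m) x).
Proof.
move=> flin; apply: freeg_span => [|b].
  split=> [|c x y hx hy] a u v.
    by rewrite -(subrr 0) !lift_is_additive !subrr scaler0 addr0.
  rewrite !fglift_linear hx hy !scalerDr !scalerA [c * a]mulrC -!addrA.
  by congr (_ + _); rewrite addrCA.
by move=> a u v; rewrite !liftU !scale1r flin.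
Qed.

End FreeModule.

HB.mixin Record isLieAlgebra (K : fieldType) g of GRing.Lmodule K g := {
  lie_bracket : g -> g -> g;
  lie_linearl : forall y, linear (lie_bracket^~ y);
  lie_linearr : forall x, linear (lie_bracket x);
  lie_alternating : forall x, lie_bracket x x = 0;
  lie_jacobi : forall x y z,
    lie_bracket x (lie_bracket y z) + lie_bracket y (lie_bracket z x)
      + lie_bracket z (lie_bracket x y) = 0
}.

#[short(type="lieAlgType")]
HB.structure Definition LieAlgebra (K : fieldType) :=
  {g of isLieAlgebra K g & GRing.Lmodule K g}.

HB.mixin Record isLieModule (K : fieldType) (g : lieAlgType K) M
    of GRing.Lmodule K M := {
  lie_act : g -> M -> M;
  lie_act_linearl : forall v, linear (lie_act^~ v);
  lie_act_linearr : forall x, linear (lie_act x);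
  lie_act_bracket : forall x y v,
    lie_act (lie_bracket x y) v
      = lie_act x (lie_act y v) - lie_act y (lie_act x v)
}.

#[short(type="lieModType")]
HB.structure Definition LieModule (K : fieldType) (g : lieAlgType K) :=
  {M of isLieModule K g M & GRing.Lmodule K M}.

Section Irreducibility.
Context (K : fieldType) (g : lieAlgType K).

Definition lie_subalgebra (S : g -> Prop) : Prop :=
  subspace S /\ forall x y, S x -> S y -> S (lie_bracket x y).

(* [S] is meant to be a Lie subalgebra of [g]; [M] is then regarded as an
   [S]-module by restriction. *)
Definition submodule_over (S : g -> Prop) (M : lieModType g)
    (W : M -> Prop) : Prop :=
  subspace W /\ forall x v, S x -> W v -> W (lie_act x v).

Definition irreducible_over (S : g -> Prop) (M : lieModType g) : Prop :=
  (exists v : M, v != 0) /\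
  forall W : M -> Prop, submodule_over S W ->
    (forall v, W v -> v = 0) \/ (forall v, W v).

Definition irreducible (M : lieModType g) : Prop :=
  irreducible_over (fun _ => True) M.

End Irreducibility.

Section TensorSpace.
Context (K : fieldType) (M N : lmodType K).
Local Notation free := {freeg (M * N)%type / K}.

Inductive tensor_relation : free -> Prop :=
| TensorRelL (a : K) (m m' : M) (n : N) :
    tensor_relation
      (<< (a *: m + m', n) >> - (a *: << (m, n) >> + << (m', n) >>))
| TensorRelR (a : K) (m : M) (n n' : N) :
    tensor_relation
      (<< (m, a *: n + n') >> - (a *: << (m, n) >> + << (m, n') >>)).

Definition tensor_null : {pred free} :=
  fun x => `[< span tensor_relation x >].

Lemma tensor_null_zmod_closed : zmod_closed tensor_null.
Proof.
have [S0 Slin] := span_subspace tensor_relation.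
split=> [|x y /asboolP Sx /asboolP Sy]; apply/asboolP => //.
by rewrite addrC -scaleN1r; apply: Slin.
Qed.

HB.instance Definition _ :=
  GRing.isZmodClosed.Build free tensor_null tensor_null_zmod_closed.

Definition tensor : Type := Quotient.quot tensor_null.

HB.instance Definition _ := Choice.on tensor.
HB.instance Definition _ := GRing.Zmodule.on tensor.
HB.instance Definition _ := Quotient.on tensor.

Let cls (x : free) : tensor := \pi_tensor x.

Lemma tensor_eqP (x y : free) :
  cls x = cls y <-> span tensor_relation (x - y).
Proof.
have E : ((x - y) \in tensor_null) = (cls x == cls y).
  exact: Quotient.idealrBE.
split=> [/eqP|/asboolP xy]; first by rewrite -E => /asboolP.
by apply/eqP; rewrite -E.
Qed.

Let clsB x y : cls (x - y) = cls x - cls y.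
Proof. by rewrite /cls [LHS]raddfB. Qed.

Let cls0 : cls 0 = 0. Proof. by rewrite -(subrr 0) clsB subrr. Qed.

Let clsD x y : cls (x + y) = cls x + cls y.
Proof. by rewrite -{1}[y]opprK -[- y]sub0r !clsB cls0 sub0r opprK. Qed.

Definition tensor_scale (a : K) (t : tensor) : tensor := cls (a *: repr t).

Let clsZ a x : cls (a *: x) = tensor_scale a (cls x).
Proof.
apply/tensor_eqP; rewrite -scalerBr -[_ *: _]addr0.
have [S0 Slin] := span_subspace tensor_relation.
by apply: Slin => //; apply/tensor_eqP; rewrite /cls reprK.
Qed.

Let clsP (P : tensor -> Prop) : (forall x, P (cls x)) -> forall t, P t.
Proof. by move=> Pcls t; rewrite -[t]reprK. Qed.

Lemma tensor_scaleA a b t :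
  tensor_scale a (tensor_scale b t) = tensor_scale (a * b) t.
Proof. by elim/clsP: t => x; rewrite -!clsZ scalerA. Qed.

Lemma tensor_scale1 : left_id 1 tensor_scale.
Proof. by elim/clsP => x; rewrite -clsZ scale1r. Qed.

Lemma tensor_scaleDr : right_distributive tensor_scale +%R.
Proof.
move=> a; elim/clsP=> x; elim/clsP=> y.
by rewrite -clsD -!clsZ -clsD scalerDr.
Qed.

Lemma tensor_scaleDl t : {morph tensor_scale^~ t : a b / a + b}.
Proof. by elim/clsP: t => x a b; rewrite -!clsZ -clsD scalerDl. Qed.

HB.instance Definition _ := GRing.Zmodule_isLmodule.Build K tensor
  tensor_scaleA tensor_scale1 tensor_scaleDr tensor_scaleDl.

Definition tens (m : M) (n : N) : tensor := cls << (m, n) >>.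

Let cls_linear : linear cls.
Proof. by move=> a x y; rewrite clsD clsZ. Qed.

Lemma tens_linearl n : linear (tens^~ n).
Proof.
move=> a m m'; rewrite /tens -cls_linear; apply/tensor_eqP/span_incl.
exact: TensorRelL.
Qed.

Lemma tens_linearr m : linear (tens m).
Proof.
move=> a n n'; rewrite /tens -cls_linear; apply/tensor_eqP/span_incl.
exact: TensorRelR.
Qed.

Lemma tensor_span (W : tensor -> Prop) :
  subspace W -> (forall m n, W (tens m n)) -> forall t, W t.
Proof.
move=> [W0 Wlin] Wt; elim/clsP; apply: freeg_span => [|[m n]]; last exact: Wt.
by split=> [|a u v Wu Wv]; rewrite (cls0, cls_linear) //; apply: Wlin.
Qed.

Definition tensor_lift (P : lmodType K) (f : M -> N -> P) (t : tensor) : P :=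
  fglift (fun p : (M * N)%type => f p.1 p.2) (repr t).

Section Lift.
Context (P : lmodType K) (f : M -> N -> P).
Hypothesis f_linearl : forall n, linear (f^~ n).
Hypothesis f_linearr : forall m, linear (f m).
Let F := fglift (fun p : (M * N)%type => f p.1 p.2).

Let F_linear : linear F. Proof. exact: fglift_linear. Qed.
Let FB x y : F (x - y) = F x - F y. Proof. exact: lift_is_additive. Qed.
Let F0 : F 0 = 0. Proof. by rewrite -(subrr 0) FB subrr. Qed.

Let tensor_lift_cls x : tensor_lift f (cls x) = F x.
Proof.
apply/eqP; rewrite -subr_eq0 -FB; apply/eqP.
have: span tensor_relation (repr (cls x) - x).
  by apply/tensor_eqP; rewrite /cls reprK.
apply: (span_min (W := fun y => F y = 0)) => [|_ [a m m' n|a m n n']].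
- by split=> // a u v Fu Fv; rewrite F_linear Fu Fv scaler0 addr0.
- by rewrite FB F_linear /F !liftU !scale1r /= f_linearl subrr.
- by rewrite FB F_linear /F !liftU !scale1r /= f_linearr subrr.
Qed.

Lemma tensor_liftE m n : tensor_lift f (tens m n) = f m n.
Proof. by rewrite tensor_lift_cls /F liftU scale1r. Qed.

Lemma tensor_lift_linear : linear (tensor_lift f).
Proof.
move=> a; elim/clsP=> x; elim/clsP=> y.
by rewrite -cls_linear !tensor_lift_cls F_linear.
Qed.

End Lift.

Lemma tensor_lift_unique (P : lmodType K) (phi psi : tensor -> P) :
  linear phi -> linear psi ->
  (forall m n, phi (tens m n) = psi (tens m n)) -> phi =1 psi.
Proof.
have lin0 (f : tensor -> P) : linear f -> f 0 = 0.
  by move=> fl; have := fl (-1) 0 0; rewrite !scaleN1r oppr0 addr0 addNr.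
move=> phil psil eq_tens; apply: tensor_span => //.
split=> [|a u v hu hv]; first by rewrite !lin0.
by rewrite phil psil hu hv.
Qed.

End TensorSpace.

Section TensorModule.
Context (K : fieldType) (g : lieAlgType K) (M N : lieModType g).

Definition tens_act (x : g) (m : M) (n : N) : tensor M N :=
  let xm : M := lie_act x m in let xn : N := lie_act x n in
  tens xm n + tens m xn.

Definition tensor_act (x : g) : tensor M N -> tensor M N :=
  tensor_lift (tens_act x).

Let tens_act_linearl x n : linear ((tens_act x)^~ n).
Proof.
move=> a u v /=; rewrite /tens_act lie_act_linearr !tens_linearl scalerDr.
by rewrite addrACA.
Qed.

Let tens_act_linearr x m : linear (tens_act x m).
Proof.
move=> a u v /=; rewrite /tens_act lie_act_linearr !tens_linearr scalerDr.
by rewrite addrACA.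
Qed.

Lemma tensor_actE x m n :
  tensor_act x (tens m n) = tens_act x m n.
Proof. exact: tensor_liftE. Qed.

Lemma tensor_act_linearr x : linear (tensor_act x).
Proof. exact: tensor_lift_linear. Qed.

Let tensor_actD x t u : tensor_act x (t + u) = tensor_act x t + tensor_act x u.
Proof. by have := tensor_act_linearr x 1 t u; rewrite !scale1r. Qed.

Let tensor_act0 x : tensor_act x 0 = 0.
Proof. by apply: (addIr (tensor_act x 0)); rewrite -tensor_actD !add0r. Qed.

Lemma tensor_act_linearl t : linear (tensor_act^~ t).
Proof.
move=> a x y /=; move: t; apply: tensor_span => [|m n].
  split=> [|b u v hu hv]; first by rewrite !tensor_act0 scaler0 addr0.
  rewrite !tensor_act_linearr hu hv !scalerDr !scalerA mulrC.
  by rewrite addrACA.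
rewrite !tensor_actE /tens_act /= !lie_act_linearl tens_linearl tens_linearr scalerDr.
by rewrite addrACA.
Qed.

Lemma tensor_act_bracket x y t :
  tensor_act (lie_bracket x y) t
    = tensor_act x (tensor_act y t) - tensor_act y (tensor_act x t).
Proof.
move: t; apply: tensor_span => [|m n].
  split=> [|b u v hu hv]; first by rewrite !tensor_act0 subr0.
  rewrite !tensor_act_linearr hu hv scalerBr opprD.
  by rewrite addrACA.
have tBl (u v : M) (w : N) : tens (u - v) w = tens u w - tens v w.
  by rewrite addrC -scaleN1r tens_linearl scaleN1r addrC.
have tBr (w : M) (u v : N) : tens w (u - v) = tens w u - tens w v.
  by rewrite addrC -scaleN1r tens_linearr scaleN1r addrC.
rewrite !tensor_actE /tens_act /= !tensor_actD !tensor_actE /tens_act /=.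
rewrite !lie_act_bracket tBl tBr [in RHS]opprD [RHS]addrACA.
set p := tens (lie_act y m) (lie_act x n).
set q := tens (lie_act x m) (lie_act y n).
rewrite ![in RHS]opprD [X in _ = X + _]addrACA [X in _ = _ + X]addrACA.
have pq : (p - q) + (q - p) = 0 by rewrite -[p - q]opprB addNr.
by rewrite -[RHS]addrA [X in _ = _ + X]addrA pq add0r.
Qed.

HB.instance Definition _ := isLieModule.Build K g (tensor M N)
  tensor_act_linearl tensor_act_linearr tensor_act_bracket.

End TensorModule.

Section TensorFamily.
Context (K : fieldType) (g : lieAlgType K).

Definition trivial_module of lieAlgType K : Type := K.

HB.instance Definition _ := GRing.Lmodule.copy (trivial_module g) K^o.

Lemma trivial_act_linearl (v : trivial_module g) :
  linear (fun _ : g => 0 : trivial_module g).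
Proof. by move=> a x y; rewrite scaler0 addr0. Qed.

Lemma trivial_act_linearr (x : g) :
  linear (fun _ : trivial_module g => 0 : trivial_module g).
Proof. by move=> a u v; rewrite scaler0 addr0. Qed.

Lemma trivial_act_bracket (x y : g) (v : trivial_module g) :
  0 = 0 - 0 :> trivial_module g.
Proof. by rewrite subr0. Qed.

HB.instance Definition _ := isLieModule.Build K g (trivial_module g)
  trivial_act_linearl trivial_act_linearr trivial_act_bracket.

Fixpoint tensor_seq (s : seq (lieModType g)) : lieModType g :=
  match s with
  | [::] => trivial_module g
  | [:: M] => M
  | M :: s' => tensor M (tensor_seq s')
  end.

(* [M 0 (x) (M 1 (x) (... (x) M (n-1)))]; the empty product is the trivial
   one-dimensional module. *)
Definition bigtensor (n : nat) (M : 'I_n -> lieModType g) : lieModType g :=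
  tensor_seq [seq M i | i <- enum 'I_n].

End TensorFamily.

Section Linear.
Context (K : fieldType) (U V : lmodType K) (f : U -> V).
Hypothesis f_lin : linear f.

Lemma linear_D u v : f (u + v) = f u + f v.
Proof. by have := f_lin 1 u v; rewrite !scale1r. Qed.

Lemma linear_0 : f 0 = 0.
Proof. by apply: (addIr (f 0)); rewrite -linear_D !add0r. Qed.

Lemma linear_Z a u : f (a *: u) = a *: f u.
Proof. by have := f_lin a u 0; rewrite linear_0 !addr0. Qed.

End Linear.

(* [Some m] indexes the basis vector L_m and [None] the central one C. *)
Definition virasoro (K : fieldType) : Type := {freeg (option int) / K}.

Section Virasoro.
Context (K : fieldType).
Local Notation vir := (virasoro K).

HB.instance Definition _ := GRing.Lmodule.on vir.

Definition virL (m : int) : vir := << Some m >>.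
Definition virC : vir := << None >>.

Definition vir_basis_bracket (a b : option int) : vir :=
  match a, b with
  | Some m, Some n =>
      (n - m)%:~R *: virL (m + n)
        + (if m + n == 0 then (m ^+ 3 - m)%:~R / 12%:R else 0) *: virC
  | _, _ => 0
  end.

Definition vir_bracket (x y : vir) : vir :=
  fglift (fun a => fglift (vir_basis_bracket a) y) x.

Lemma vir_bracketU a b :
  vir_bracket << a >> << b >> = vir_basis_bracket a b.
Proof. by rewrite /vir_bracket !liftU !scale1r. Qed.

Lemma vir_linearl y : linear (vir_bracket^~ y).
Proof. exact: fglift_linear. Qed.

Lemma vir_linearr x : linear (vir_bracket x).
Proof. by apply: (fglift_linearr _ x) => a; apply: fglift_linear. Qed.

Lemma vir_antisymmetric x y : vir_bracket x y + vir_bracket y x = 0.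
Proof.
move: y; apply: freeg_span => [|b].
  split=> [|a u v hu hv].
    by rewrite (linear_0 (vir_linearr x)) (linear_0 (vir_linearl x)) addr0.
  by rewrite vir_linearr vir_linearl addrACA -scalerDr hu hv scaler0 addr0.
move: x; apply: freeg_span => [|c].
  split=> [|a u v hu hv].
    rewrite (linear_0 (vir_linearr << b >>)).
    by rewrite (linear_0 (vir_linearl << b >>)) addr0.
  by rewrite vir_linearr vir_linearl addrACA -scalerDr hu hv scaler0 addr0.
rewrite !vir_bracketU; case: b c => [m|] [n|] /=; rewrite ?addr0 //.
rewrite [m + n]addrC addrACA -!scalerDl.
rewrite -rmorphD -[n - m]opprB subrr scale0r add0r.
case: eqP => [/(canRL (addrK _)) ->|_]; last by rewrite addr0 scale0r.
rewrite -mulrDl -rmorphD /= (_ : _ + _ = 0) ?mul0r ?scale0r //; ring.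
Qed.

Lemma vir_alternating x : vir_bracket x x = 0.
Proof.
move: x; apply: freeg_span => [|[m|]]; last by rewrite vir_bracketU.
  split=> [|a u v hu hv]; first exact: (linear_0 (vir_linearr 0)).
  rewrite vir_linearl !vir_linearr hu hv scaler0 add0r addr0.
  by rewrite -scalerDr vir_antisymmetric scaler0.
rewrite vir_bracketU /= subrr scale0r add0r.
case: eqP => [mm|_]; last by rewrite scale0r.
have -> : m = 0 by lia.
by rewrite expr0n subrr mul0r scale0r.
Qed.

Lemma vir_jacobi x y z :
  vir_bracket x (vir_bracket y z) + vir_bracket y (vir_bracket z x)
    + vir_bracket z (vir_bracket x y) = 0.
Proof.
pose J x y z := vir_bracket x (vir_bracket y z)
  + vir_bracket y (vir_bracket z x) + vir_bracket z (vir_bracket x y).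
have JC u v w : J u v w = J v w u.
  by rewrite /J [in RHS]addrC addrA.
have Jlin v w : linear (J^~ v^~ w).
  move=> a u u'; rewrite /J !(vir_linearl, vir_linearr) !scalerDr.
  by rewrite [X in X + _ = _]addrACA [LHS]addrACA.
rewrite -/(J x y z).
move: x; apply: freeg_span => [|a].
  by split=> [|c u v hu hv]; rewrite ?(linear_0 (Jlin _ _)) // Jlin hu hv
    scaler0 addr0.
rewrite JC; move: y; apply: freeg_span => [|b].
  by split=> [|c u v hu hv]; rewrite ?(linear_0 (Jlin _ _)) // Jlin hu hv
    scaler0 addr0.
rewrite JC; move: z; apply: freeg_span => [|c].
  by split=> [|d u v hu hv]; rewrite ?(linear_0 (Jlin _ _)) // Jlin hu hv
    scaler0 addr0.
have L0 u : vir_bracket u 0 = 0 by exact: (linear_0 (vir_linearr u)).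
have LC u : vir_bracket << u >> virC = 0.
  by rewrite vir_bracketU; case: u.
have LL (l : int) (u v : option int) : vir_bracket << Some l >>
    (vir_basis_bracket u v) = match u, v with Some m, Some n =>
      ((n - m) * (m + n - l))%:~R *: virL (l + (m + n)) +
      (if l + (m + n) == 0 then ((n - m) * (l ^+ 3 - l))%:~R / 12%:R else 0)
        *: virC | _, _ => 0 end.
  case: u v => [m|] [n|]; rewrite ?L0 //= vir_linearr.
  rewrite (linear_Z (vir_linearr _)) LC scaler0 addr0 vir_bracketU /=.
  rewrite scalerDr !scalerA -intrM; congr (_ + _ *: _).
  by case: eqP; rewrite ?mulr0 // rmorphM mulrA.
have CL (v w : option int) : vir_bracket << None >> (vir_basis_bracket v w) = 0.
  have C0 z : vir_bracket << None >> z = 0.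
    move: z; apply: freeg_span => [|b']; last by rewrite vir_bracketU.
    by split=> [|d u' v' hu hv]; rewrite ?L0 // vir_linearr hu hv
      scaler0 addr0.
  exact: C0.
have comb (u v : vir) c1 c2 c3 d1 d2 d3 :
    c1 *: u + d1 *: v + (c2 *: u + d2 *: v) + (c3 *: u + d3 *: v)
      = (c1 + c2 + c3) *: u + (d1 + d2 + d3) *: v.
  by rewrite !scalerDl [X in X + _ = _]addrACA [LHS]addrACA.
rewrite /J !vir_bracketU.
case: a b c => [l|] [m|] [n|]; rewrite ?CL ?LL ?addr0 //=.
rewrite (_ : l + (m + n) = n + (l + m)); last by ring.
rewrite (_ : m + (n + l) = n + (l + m)); last by ring.
rewrite comb -!rmorphD /= (_ : _ + _ + _ = 0); last by ring.
rewrite scale0r add0r; case: eqP => [e|_]; last by rewrite !addr0 scale0r.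
rewrite -!mulrDl -!rmorphD /= (_ : _ + _ + _ = 0) ?mul0r ?scale0r //.
by rewrite (_ : n = - (l + m)); [ring | lia].
Qed.

HB.instance Definition _ := isLieAlgebra.Build K vir
  vir_linearl vir_linearr vir_alternating vir_jacobi.

Definition vir_gt (r : nat) : vir -> Prop :=
  span (fun x => exists2 i : int, r%:Z < i & x = virL i).

Lemma vir_gt_subalgebra r : lie_subalgebra (vir_gt r).
Proof.
have Sr : subspace (vir_gt r) by apply: span_subspace.
split=> // x y Sx Sy.
apply: (span_min (W := fun x => vir_gt r (lie_bracket x y))) Sx.
  split=> [|a u v hu hv].
    by rewrite [lie_bracket _ _](linear_0 (vir_linearl y)); case: Sr.
  by rewrite [lie_bracket _ _]vir_linearl; apply: Sr.2.
move=> _ [i ri ->].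
apply: (span_min (W := fun y => vir_gt r (lie_bracket (virL i) y))) Sy.
  split=> [|a u v hu hv].
    by rewrite [lie_bracket _ _](linear_0 (vir_linearr _)); case: Sr.
  by rewrite [lie_bracket _ _]vir_linearr; apply: Sr.2.
move=> _ [j rj ->].
rewrite [lie_bracket _ _]vir_bracketU /= (_ : i + j == 0 = false).
  by rewrite scale0r; apply: Sr.2; [apply: span_incl; exists (i + j) => //; lia
    | case: Sr].
by apply/eqP; lia.
Qed.



End Virasoro.

Section VectorField.
Context (A : comNzRingType) (D : A -> A) (s t a H G : A).

Definition vector_field (m : int) (u : A) : A :=
  (s + m%:~R * H - (m * (m - 1))%:~R * a * G) * u
    - m%:~R * (t - m%:~R * a) * D u.

Lemma vector_field_bracket (c : A) :
  {morph D : x y / x + y} -> (forall x y, D (x * y) = D x * y + x * D y) ->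
  D s = 0 -> D t = 1 -> D a = 0 -> D c = 0 -> H = G * (t - a) + c ->
  forall m n u,
  vector_field m
      ((s - m%:~R + n%:~R * H - (n * (n - 1))%:~R * a * G) * u
        - n%:~R * (t - n%:~R * a) * D u)
  - vector_field n
      ((s - n%:~R + m%:~R * H - (m * (m - 1))%:~R * a * G) * u
        - m%:~R * (t - m%:~R * a) * D u)
  = (n - m)%:~R * vector_field (m + n) u.
Proof.
move=> DD DM Ds Dt Da Dc Hc m n u; rewrite /vector_field !Hc.
have D0 : D 0 = 0 by apply: (addIr (D 0)); rewrite -DD !add0r.
have DN x : D (- x) = - D x.
  by apply: (addIr (D x)); rewrite -DD !addNr.
have D1 : D 1 = 0 by apply: (addIr (D 1)); have := DM 1 1; rewrite !mulr1 mul1r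
  add0r => <-.
have Dn (k : nat) : D k%:R = 0.
  by elim: k => [|k IH]; rewrite ?mulrS ?DD ?D1 ?IH ?addr0.
have Dz (k : int) : D k%:~R = 0.
  by case: k => k; rewrite ?NegzE ?rmorphN /= ?DN Dn ?oppr0.
rewrite !(DD, DN, DM, Dz, Ds, Dt, Da, Dc) !(rmorphM, rmorphB, rmorphD) /=.
ring.
Qed.

End VectorField.

Section Phi.
Context (K : fieldType).
Local Notation Kst := {mpoly K[2]}.
Local Notation "''s'" := ('X_(ord0 : 'I_2) : Kst) (at level 0).
Local Notation "''t'" := ('X_(ord_max : 'I_2) : Kst) (at level 0).

Definition in_t (p : {poly K}) : Kst := (map_poly (@mpolyC 2 K) p).['t].

Definition shift_s (m : int) (f : Kst) : Kst :=
  f \mPo [tuple 's - m%:~R; 't].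

Definition d_dt (f : Kst) : Kst := mderiv ord_max f.

Definition divided_difference (h : {poly K}) (al : K) : {poly K} :=
  (h - h.[al]%:P) %/ ('X - al%:P).

Definition Phi_L (lam al : K) (h : {poly K}) (m : int) (f : Kst) : Kst :=
  lam ^ m *:
    (('s + m%:~R * in_t h
        - (m * (m - 1))%:~R * al%:MP * in_t (divided_difference h al))
       * shift_s m f
     - m%:~R * ('t - m%:~R * al%:MP) * d_dt (shift_s m f)).

Lemma in_tD : {morph in_t : p q / p + q}.
Proof. by move=> p q; rewrite /in_t rmorphD hornerD. Qed.

Lemma in_tM : {morph in_t : p q / p * q}.
Proof. by move=> p q; rewrite /in_t rmorphM hornerM. Qed.

Lemma in_tX : in_t 'X = 't.
Proof. by rewrite /in_t map_polyX hornerX. Qed.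

Lemma in_tC c : in_t c%:P = c%:MP.
Proof. by rewrite /in_t map_polyC hornerC. Qed.

Lemma divided_differenceE h al :
  h = divided_difference h al * ('X - al%:P) + h.[al]%:P.
Proof.
rewrite divpK ?subrK // dvdp_XsubCl.
by rewrite /root !hornerE subrr.
Qed.

Lemma shift_sD m : {morph shift_s m : f f' / f + f'}.
Proof. exact: rmorphD. Qed.

Lemma shift_sM m : {morph shift_s m : f f' / f * f'}.
Proof. exact: rmorphM. Qed.

Lemma shift_sN m : {morph shift_s m : f / - f}.
Proof. exact: rmorphN. Qed.

Lemma shift_sZ m c : {morph shift_s m : f / c *: f}.
Proof. exact: linearZ. Qed.

Lemma shift_sC m c : shift_s m c%:MP = c%:MP.
Proof. exact: comp_mpolyC. Qed.

Lemma shift_s_int m k : shift_s m k%:~R = k%:~R.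
Proof. exact: rmorph_int. Qed.

Lemma shift_s_s m : shift_s m 's = 's - m%:~R.
Proof. by rewrite /shift_s comp_mpolyXU. Qed.

Lemma shift_s_t m : shift_s m 't = 't.
Proof. by rewrite /shift_s comp_mpolyXU. Qed.

Lemma Kst_ind (P : Kst -> Prop) :
  (forall c, P c%:MP) -> P 's -> P 't ->
  (forall f f', P f -> P f' -> P (f + f')) ->
  (forall f f', P f -> P f' -> P (f * f')) -> forall f, P f.
Proof.
move=> PC Ps Pt PD PM f; rewrite (mpolyE f).
elim/big_rec: _ => [|m x _ Px]; first by rewrite -mpolyC0.
apply: PD Px; rewrite -mul_mpolyC mpolyXE_id; apply: (PM) => //.
have PX (g : Kst) k : P g -> P (g ^+ k).
  move=> Pg; elim: k => [|k IH]; first by rewrite expr0 -mpolyC1.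
  by rewrite exprS; apply: (PM).
by rewrite big_ord_recl big_ord1; apply: (PM); apply: PX;
   rewrite ?(_ : lift _ _ = ord_max) //; apply: val_inj.
Qed.

Lemma shift_s_in_t m p : shift_s m (in_t p) = in_t p.
Proof.
elim/poly_ind: p => [|p c IH].
  by rewrite -[0]/(0%:P) in_tC shift_sC.
by rewrite in_tD in_tM in_tX in_tC shift_sD shift_sM IH shift_s_t shift_sC.
Qed.

Lemma shift_s_add m n f : shift_s m (shift_s n f) = shift_s (m + n) f.
Proof.
elim/Kst_ind: f => [c|||f f' hf hf'|f f' hf hf'].
- by rewrite !shift_sC.
- rewrite !shift_s_s shift_sD shift_sN shift_s_s shift_s_int rmorphD /=; ring.
- by rewrite !shift_s_t.
- by rewrite !shift_sD hf hf'.
- by rewrite !shift_sM hf hf'.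
Qed.

Lemma d_dtD : {morph d_dt : f f' / f + f'}. Proof. exact: mderivD. Qed.
Lemma d_dtB : {morph d_dt : f f' / f - f'}. Proof. exact: mderivB. Qed.
Lemma d_dtM f f' : d_dt (f * f') = d_dt f * f' + f * d_dt f'.
Proof. exact: mderivM. Qed.
Lemma d_dtC c : d_dt c%:MP = 0. Proof. exact: mderivC. Qed.
Lemma d_dt_int k : d_dt k%:~R = 0.
Proof. by rewrite -(rmorph_int (@mpolyC 2 K)) d_dtC. Qed.
Lemma d_dtZ c f : d_dt (c *: f) = c *: d_dt f. Proof. exact: mderivZ. Qed.

Lemma d_dt_s : d_dt 's = 0.
Proof. by rewrite /d_dt mderivX mnm1E scale0r. Qed.

Lemma d_dt_t : d_dt 't = 1.
Proof. by rewrite /d_dt mderivX mnm1E eqxx scale1r -[X in (X - _)%MM]add0m addmK mpolyX0. Qed.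

Lemma d_dt_in_t p : d_dt (in_t p) = in_t p^`().
Proof.
elim/poly_ind: p => [|p c IH].
  by rewrite deriv0 -[0]/(0%:P) in_tC d_dtC.
rewrite in_tD in_tM in_tX in_tC d_dtD d_dtM IH d_dt_t d_dtC.
by rewrite mulr1 addr0 derivD derivC addr0 derivM derivX mulr1 in_tD in_tM in_tX.
Qed.

Lemma d_dt_shift m f : d_dt (shift_s m f) = shift_s m (d_dt f).
Proof.
elim/Kst_ind: f => [c|||f f' hf hf'|f f' hf hf'].
- by rewrite shift_sC !d_dtC -mpolyC0 shift_sC.
- by rewrite shift_s_s d_dtB !d_dt_s d_dt_int subr0 -mpolyC0 shift_sC.
- by rewrite shift_s_t d_dt_t -mpolyC1 shift_sC.
- by rewrite shift_sD !d_dtD shift_sD hf hf'.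
- by rewrite shift_sM !d_dtM shift_sD !shift_sM hf hf'.
Qed.

Lemma Phi_L_linear (lam al : K) (h : {poly K}) (m : int) : linear (Phi_L lam al h m).
Proof.
move=> a f f'; rewrite /Phi_L shift_sD shift_sZ d_dtD d_dtZ.
set P := 's + _ - _; set Q := _ * ('t - _).
rewrite !mulrDr -!scalerAr opprD addrACA -scalerBr scalerDr !scalerA.
by rewrite mulrC.
Qed.

Lemma Phi_L_comp (lam al : K) (h : {poly K}) (m n : int) f : lam != 0 ->
  let H := in_t h in let G := in_t (divided_difference h al) in
  let u := shift_s (m + n) f in
  Phi_L lam al h m (Phi_L lam al h n f) =
    lam ^ (m + n) *: vector_field d_dt 's 't al%:MP H G m
      (('s - m%:~R + n%:~R * H - (n * (n - 1))%:~R * al%:MP * G) * u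
        - n%:~R * ('t - n%:~R * al%:MP) * d_dt u).
Proof.
move=> lam0 /=; rewrite /Phi_L !(shift_sZ, d_dtZ, shift_sD, shift_sN, shift_sM).
rewrite !(shift_sN, shift_sM, shift_s_in_t, shift_s_int, shift_sC, shift_s_s, shift_s_t).
rewrite -!d_dt_shift !shift_s_add -!scalerAr -scalerBr scalerA expfzDr //.
Qed.

Lemma Phi_L_bracket (lam al : K) (h : {poly K}) (m n : int) f : lam != 0 ->
  Phi_L lam al h m (Phi_L lam al h n f) - Phi_L lam al h n (Phi_L lam al h m f)
    = (n - m)%:~R *: Phi_L lam al h (m + n) f.
Proof.
move=> lam0; rewrite !Phi_L_comp //= [n + m]addrC -scalerBr.
have H_G : in_t h = in_t (divided_difference h al) * ('t - al%:MP) + h.[al]%:MP.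
  rewrite [in LHS](divided_differenceE h al) in_tD in_tM in_tC.
  by rewrite in_tD in_tX -polyCN in_tC mpolyCN.
rewrite (vector_field_bracket d_dtD d_dtM d_dt_s d_dt_t (d_dtC _) (d_dtC _) H_G).
rewrite /Phi_L -/(vector_field _ _ _ _ _ _ _ _).
rewrite [RHS]scalerA [X in _ = X *: _]mulrC -[RHS]scalerA.
congr (_ *: _); rewrite -mul_mpolyC; congr (_ * _).
by rewrite -(rmorph_int (@mpolyC 2 K)).
Qed.

(* For [lam = 0] the operators [Phi_L] do not define a module. *)
Definition Phi (lam al : K) (h : {poly K}) of lam != 0 : Type := Kst.

Section Module.
Context (lam al : K) (h : {poly K}) (lam0 : lam != 0).
Local Notation M := (Phi al h lam0).

HB.instance Definition _ := GRing.Lmodule.on M.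

Definition Phi_basis_act (b : option int) (f : M) : M :=
  if b is Some m then Phi_L lam al h m f else 0.

Definition Phi_act (x : virasoro K) (f : M) : M :=
  fglift (fun b => Phi_basis_act b f) x.

Lemma Phi_act_linearl f : linear (Phi_act^~ f).
Proof. exact: fglift_linear. Qed.

Lemma Phi_act_linearr x : linear (Phi_act x).
Proof.
apply: (fglift_linearr _ x) => -[m|] /=; first exact: Phi_L_linear.
by move=> a f f'; rewrite scaler0 addr0.
Qed.

Lemma Phi_actU b f : Phi_act << b >> f = Phi_basis_act b f.
Proof. by rewrite /Phi_act liftU scale1r. Qed.

Lemma Phi_act_bracket x y f :
  Phi_act (lie_bracket x y) f
    = Phi_act x (Phi_act y f) - Phi_act y (Phi_act x f).
Proof.
have l0 := linear_0 (Phi_act_linearl _).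
have r0 z : Phi_act z 0 = 0 := linear_0 (Phi_act_linearr z).
move: x; apply: freeg_span => [|b].
  split=> [|a u v hu hv].
    by rewrite [lie_bracket _ _](linear_0 (vir_linearl y)) !l0 r0 subrr.
  rewrite [lie_bracket _ _]vir_linearl !Phi_act_linearl Phi_act_linearr hu hv.
  by rewrite scalerBr opprD addrACA.
move: y; apply: freeg_span => [|c].
  split=> [|a u v hu hv].
    by rewrite [lie_bracket _ _](linear_0 (vir_linearr _)) !l0 r0 subrr.
  rewrite [lie_bracket _ _]vir_linearr !Phi_act_linearl Phi_act_linearr hu hv.
  by rewrite scalerBr opprD addrACA.
rewrite [lie_bracket _ _]vir_bracketU !Phi_actU.
case: b c => [m|] [n|] /=; rewrite ?Phi_actU /=.
- rewrite Phi_act_linearl (linear_Z (Phi_act_linearl f)) !Phi_actU /=.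
  by rewrite scaler0 addr0 Phi_L_bracket.
- by rewrite l0 (linear_0 (Phi_L_linear _ _ _ _)) subrr.
- by rewrite l0 (linear_0 (Phi_L_linear _ _ _ _)) subrr.
- by rewrite l0 subrr.
Qed.

HB.instance Definition _ := isLieModule.Build K (virasoro K) M
  Phi_act_linearl Phi_act_linearr Phi_act_bracket.

End Module.
End Phi.

(* Main.v *)
From HB Require Import structures.
Require Import Defs.
From mathcomp Require Import all_boot all_order all_algebra.
From mathcomp Require Import reals complex.
From mathcomp Require Import boolp mpoly ring zify.

(** Since [h = c t + d], on a given vector of [Phi lam al h] the operator [L_m]
    is [lam ^ m] times a polynomial in [m], whose coefficients are operators
    [X_k]. On [V] all [L_m] with [m] large annihilate a given vector. Hence on a
    vector of the tensor product [L_m] is, for [m] large, an exponential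
    polynomial with pairwise distinct bases [lam i], so a subspace invariant
    under [L_m] for all [m > r] is invariant under every [X_k] acting on a
    single factor. Writing [D = d/dt - c], the top nonvanishing [X_k] acts on
    a vector of [s]-degree [p] as a nonzero multiple of [D d_s^p]; as [D] is
    injective and [d/dt] locally nilpotent, such operators bring a nonzero
    vector of the subspace to some [1 (x) u <> 0], and [X_0 = s] and [X_1] then
    give all of [Phi (x) u]. Peeling the factors off one by one, the subspace
    contains [PhiT (x) v] for some [v <> 0] in [V], and the set of such
    [v] is a submodule of [V].

    That each [v] in [V] is killed by [L_m] for [m] large: such vectors form a
    submodule, so one nonzero [v] suffices. Some [L_n] has an eigenvector [v],
    and a nonzero polynomial [q] satisfies [q (ad L_n) (L_j) v = 0] for all
    [j > n]. The bracket of the instances [j] and [N - j] of this relation is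
    polynomial in [j], and its leading coefficient is a nonzero multiple of a
    single [L_M v]. *)

Set Implicit Arguments.
Unset Strict Implicit.
Unset Printing Implicit Defensive.

Import Order.TTheory GRing.Theory Num.Theory.
Local Open Scope ring_scope.

(** * Closure properties of subspaces given as predicates *)

Section Subspace.
Context (K : fieldType) (V : lmodType K) (W : V -> Prop) (W_sub : subspace W).

Lemma subspaceZ a u : W u -> W (a *: u).
Proof. by move=> Wu; rewrite -[_ *: _]addr0; apply: W_sub.2 => //; case: W_sub. Qed.

Lemma subspaceD u v : W u -> W v -> W (u + v).
Proof. by move=> Wu Wv; rewrite -[u]scale1r; apply: W_sub.2. Qed.

Lemma subspaceB u v : W u -> W v -> W (u - v).
Proof. by move=> Wu Wv; rewrite addrC -scaleN1r; apply: W_sub.2. Qed.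

Lemma subspace_sum (I : Type) (r : seq I) (P : pred I) (F : I -> V) :
  (forall i, P i -> W (F i)) -> W (\sum_(i <- r | P i) F i).
Proof.
move=> WF; elim/big_rec: _ => [|i x Pi Wx]; first by case: W_sub.
by apply: subspaceD => //; apply: WF.
Qed.

Lemma subspaceZK a u : a != 0 -> W (a *: u) -> W u.
Proof.
by move=> a0 /(subspaceZ a^-1); rewrite scalerA mulVf // scale1r.
Qed.

End Subspace.

(** * Exponential polynomials with values in a vector space *)

Section ExponentialPolynomials.
Context (K : numFieldType).
Implicit Types (p q : {poly K}) (a b : K).

(** The operator [x d/dx], which multiplies ['X^m] by [m]. Evaluating its [k]-th iterate at [a]
    therefore pairs the coefficients of [p] with the sequence [a ^ m * m ^ k]. *)
Definition euler p : {poly K} := 'X * p^`().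

Lemma coef_iter_euler p k m : (iter k euler p)`_m = p`_m * m%:R ^+ k.
Proof.
elim: k => [|k IHk] /=; first by rewrite mulr1.
rewrite coefXM coef_deriv; case: m IHk => [|m] IHk /=.
  by rewrite exprS mul0r mulr0.
by rewrite IHk exprSr mulrA mulr_natr.
Qed.

Lemma horner_iter_euler p k B a : (size p <= B)%N ->
  (iter k euler p).[a] = \sum_(m < B) p`_m * (a ^+ m * m%:R ^+ k).
Proof.
move=> pB; rewrite (@horner_coef_wide _ B).
  by apply: eq_bigr => m _; rewrite coef_iter_euler -mulrA [_ ^+ k * _]mulrC.
apply: leq_trans pB; apply/leq_sizeP => m pm.
by rewrite coef_iter_euler nth_default ?mul0r.
Qed.

Lemma eulerM_exp k a q : euler (('X - a%:P) ^+ k.+1 * q)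
  = ('X - a%:P) ^+ k * (k.+1%:R *: ('X * q) + ('X - a%:P) * euler q).
Proof.
rewrite /euler derivM deriv_exp derivXsubC mul1r /= exprS -mulr_natl scaler_nat.
by rewrite -[_ *+ k.+1 in RHS]mulr_natl; ring.
Qed.

(** Each application of [euler] lowers the multiplicity of the root [a] by at most one. *)
Lemma iter_euler_root k l a q : (l < k)%N ->
  (iter l euler (('X - a%:P) ^+ k * q)).[a] = 0.
Proof.
elim: l k q => [|l IHl] [//|k] q lk.
  by rewrite /= exprS -mulrA hornerM hornerXsubC subrr mul0r.
by rewrite iterSr eulerM_exp IHl.
Qed.

(** By [eulerM_exp] the cofactor's value at [a] is multiplied by [j.+1 * a] when the multiplicity
    drops from [j.+1] to [j], so the final value is [k! * a ^ k * q.[a]]. *)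
Lemma iter_euler_neq0 k a q : a != 0 -> q.[a] != 0 ->
  (iter k euler (('X - a%:P) ^+ k * q)).[a] != 0.
Proof.
move=> a0; elim: k q => [|k IHk] q qa; first by rewrite mul1r.
rewrite iterSr eulerM_exp; apply: IHk.
rewrite hornerD hornerZ !hornerM hornerX hornerXsubC subrr mul0r addr0.
by rewrite !mulf_neq0 // pnatr_eq0.
Qed.

(* The polynomial 'X^N * \prod_(b != a) ('X - b)^B * ('X - a)^k, read as a
   linear combination of the values at m = N, N + 1, ..., isolates the terms
   [z a l] with k <= l. *)
Lemma exppoly_coef_mem (Z : lmodType K) (W : Z -> Prop) (s : seq K) (B N : nat)
    (z : K -> nat -> Z) :
  subspace W -> uniq s -> 0 \notin s ->
  (forall m, (N <= m < N + size s * B)%N ->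
    W (\sum_(a <- s) \sum_(k < B) (a ^+ m * m%:R ^+ k) *: z a k)) ->
  forall a k, a \in s -> (k < B)%N -> W (z a k).
Proof.
move=> W_sub s_uniq s0 WF a k as_ kB.
(* Descending induction on [k]: the vectors [z a l] with [k < l < B] are already known to lie in
   [W]. *)
have [j] := ubnP (B - k); elim: j k kB => // j IHj k kB kj.
pose Q := 'X^N * \prod_(b <- rem a s) ('X - b%:P) ^+ B.
pose P := ('X - a%:P) ^+ k * Q.
(* [Q] has degree [N + (size s - 1) * B] and [k < B], so [P] combines only values at indices covered
   by the hypothesis. *)
have sizeP : (size P <= N + size s * B)%N.
  have monQ : Q \is monic.
    rewrite monicMl ?monicXn //; apply: monic_prod => b _.
    exact/monic_exp/monicXsubC.
  have sizeQ : (size Q <= N + (size s).-1 * B + 1)%N.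
    rewrite /Q mulrC size_mulXn; last first.
      by apply: monic_neq0; apply: monic_prod => b _; exact/monic_exp/monicXsubC.
    rewrite -addnA leq_add2l -(size_rem as_).
    elim: (rem a s) => [|b r IHr]; first by rewrite big_nil size_poly1.
    rewrite big_cons; apply: leq_trans (size_polyMleq _ _) _.
    by rewrite size_exp_XsubC [size (_ :: _)]/= mulSn addSn -addnA leq_add2l.
  rewrite /P size_monicM ?monic_exp ?monicXsubC ?monic_neq0 // size_exp_XsubC.
  have : (0 < size s)%N by case: (s) as_.
  case: (size s) sizeQ => //= r; lia.
have PN m : (m < N)%N -> P`_m = 0.
  by move=> mN; rewrite /P /Q mulrCA coefXnM mN.
have aQ : Q.[a] != 0.
  rewrite hornerM hornerXn horner_prod mulf_neq0 //.
    by rewrite expf_neq0 //; apply: contraNneq s0 => <-.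
  rewrite prodf_seq_neq0; apply/allP => b; rewrite rem_filter // mem_filter /=.
  by case/andP => ba _; rewrite !hornerE expf_neq0 // subr_eq0 eq_sym.
have a0 : a != 0 by apply: contraNneq s0 => <-.
apply: (subspaceZK W_sub (iter_euler_neq0 k a0 aQ)).
have: W (\sum_(b <- s) \sum_(l < B) (iter l euler P).[b] *: z b l).
  have -> : \sum_(b <- s) \sum_(l < B) (iter l euler P).[b] *: z b l
      = \sum_(m < N + size s * B) P`_m *:
        (\sum_(b <- s) \sum_(l < B) (b ^+ m * m%:R ^+ l) *: z b l).
    under [RHS]eq_bigr do rewrite scaler_sumr.
    rewrite [RHS]exchange_big /=; apply: eq_bigr => b _.
    under [RHS]eq_bigr do rewrite scaler_sumr.
    rewrite [RHS]exchange_big /=; apply: eq_bigr => l _.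
    rewrite (horner_iter_euler l b sizeP) scaler_suml.
    by apply: eq_bigr => m _; rewrite scalerA.
  apply: subspace_sum => // m _; have [/PN ->|Nm] := ltnP m N.
    by rewrite scale0r; case: W_sub.
  by apply: subspaceZ => //; apply: WF; rewrite Nm ltn_ord.
(* Apart from the term at [(a, k)], those at other bases vanish since [P] has a root of multiplicity
   at least [B] there, those at [a] with [l < k] vanish, and those with [k < l] lie in [W] by
   induction. *)
rewrite (bigD1_seq a) //= (bigD1 (Ordinal kB)) //= -addrA => Wsum.
set t := _ *: z a k in Wsum *; set r := (X in t + X) in Wsum.
have Wr : W r.
  apply: subspaceD => //; last first.
    rewrite big_seq_cond; apply: subspace_sum => // b /andP[bs ba].
    apply: subspace_sum => // l _; rewrite /P /Q (bigD1_seq b) ?rem_uniq //=.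
      rewrite ['X^N * _]mulrCA [_ ^+ k * _]mulrCA iter_euler_root // scale0r.
      by case: W_sub.
    by rewrite rem_filter // mem_filter /= ba.
  apply: subspace_sum => // l lk; have [lk'|lk'] := ltnP l k.
    by rewrite iter_euler_root // scale0r; case: W_sub.
  apply: subspaceZ => //; apply: IHj => //.
  have : (l : nat) != k by apply: contraNneq lk => lk2; apply/eqP/val_inj.
  by have := ltn_ord l; lia.
by have := subspaceB W_sub Wsum Wr; rewrite addrK.
Qed.

End ExponentialPolynomials.

(** * Maps between tensor products *)

Section LinearMaps.
Context (K : fieldType).
Implicit Types M N P : lmodType K.

Definition linear_of M N (f : M -> N) (f_lin : linear f) : {linear M -> N} :=
  HB.pack f (GRing.isLinear.Build K M N *:%R f f_lin).

Lemma linear_compose M N P (f : M -> N) (g : N -> P) :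
  linear f -> linear g -> linear (fun x => g (f x)).
Proof. by move=> f_lin g_lin a x y; rewrite f_lin g_lin. Qed.

Lemma linear_scaled M N (f : M -> N) (a : K) :
  linear f -> linear (fun x => a *: f x).
Proof. by move=> f_lin e x y; rewrite f_lin scalerDr !scalerA [e * a]mulrC. Qed.

Lemma linear_combination M N (f g : M -> N) (a b : K) :
  linear f -> linear g -> linear (fun x => a *: f x + b *: g x).
Proof.
move=> f_lin g_lin e x y; rewrite f_lin g_lin !scalerDr !scalerA addrACA.
by rewrite [e * a]mulrC [e * b]mulrC.
Qed.

Lemma linear_shift M (f : M -> M) (a : K) :
  linear f -> linear (fun x => f x - a *: x).
Proof.
move=> f_lin e x y; rewrite f_lin scalerBr scalerDr !scalerA [a * e]mulrC.
by rewrite opprD addrACA.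
Qed.

Lemma subspace_preim M N (f : M -> N) (W : N -> Prop) :
  linear f -> subspace W -> subspace (fun x => W (f x)).
Proof.
move=> f_lin [W0 Wlin]; split=> [|a x y hx hy]; first by rewrite linear_0.
by rewrite f_lin; apply: Wlin.
Qed.

Lemma subspace_forall (I : Type) M (W : I -> M -> Prop) :
  (forall i, subspace (W i)) -> subspace (fun x => forall i, W i x).
Proof.
move=> W_sub; split=> [i|a x y hx hy i]; first by case: (W_sub i).
exact: (W_sub i).2.
Qed.

End LinearMaps.

Section TensorMaps.
Context (K : fieldType).
Implicit Types M N P U : lmodType K.

Lemma tens0l M N (n : N) : tens (0 : M) n = 0.
Proof. exact: (linear_0 (@tens_linearl K M N n)). Qed.

Lemma tens0r M N (m : M) : tens m (0 : N) = 0.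
Proof. exact: (linear_0 (tens_linearr m)). Qed.

Lemma tensZl M N a (m : M) (n : N) : tens (a *: m) n = a *: tens m n.
Proof. exact: (linear_Z (@tens_linearl K M N n)). Qed.

Lemma tensZr M N a (m : M) (n : N) : tens m (a *: n) = a *: tens m n.
Proof. exact: (linear_Z (tens_linearr m)). Qed.

Lemma tens_suml M N (I : Type) (r : seq I) (F : I -> M) (n : N) :
  tens (\sum_(i <- r) F i) n = \sum_(i <- r) tens (F i) n.
Proof.
apply: (big_morph (fun m => tens m n)); last exact: tens0l.
exact: (linear_D (@tens_linearl K M N n)).
Qed.

Lemma tens_sumr M N (I : Type) (r : seq I) (F : I -> N) (m : M) :
  tens m (\sum_(i <- r) F i) = \sum_(i <- r) tens m (F i).
Proof.
apply: (big_morph (fun n => tens m n)); last exact: tens0r.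
exact: (linear_D (tens_linearr m)).
Qed.

Section Maps.
Context (M M' N N' : lmodType K).

Definition tmapl (T : {linear M -> M'}) : tensor M N -> tensor M' N :=
  tensor_lift (fun m n => tens (T m) n).

Definition tmapr (T : {linear N -> N'}) : tensor M N -> tensor M N' :=
  tensor_lift (fun m n => tens m (T n)).

Fact tmapl_bilinear (T : {linear M -> M'}) :
  (forall n : N, linear (fun m => tens (T m) n)) /\
  (forall m, linear (fun n : N => tens (T m) n)).
Proof.
split=> [n|m] a u v; first by rewrite linearP tens_linearl.
exact: tens_linearr.
Qed.

Fact tmapr_bilinear (T : {linear N -> N'}) :
  (forall n, linear (fun m : M => tens m (T n))) /\
  (forall m : M, linear (fun n => tens m (T n))).
Proof.
split=> [n|m] a u v; last by rewrite linearP tens_linearr.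
exact: tens_linearl.
Qed.

Lemma tmaplE T m n : tmapl T (tens m n) = tens (T m) n.
Proof. by have [? ?] := tmapl_bilinear T; rewrite /tmapl tensor_liftE. Qed.

Lemma tmaprE T m n : tmapr T (tens m n) = tens m (T n).
Proof. by have [? ?] := tmapr_bilinear T; rewrite /tmapr tensor_liftE. Qed.

Fact tmapl_linear T : linear (tmapl T).
Proof. by have [? ?] := tmapl_bilinear T; apply: tensor_lift_linear. Qed.

Fact tmapr_linear T : linear (tmapr T).
Proof. by have [? ?] := tmapr_bilinear T; apply: tensor_lift_linear. Qed.

HB.instance Definition _ T :=
  GRing.isLinear.Build K _ _ *:%R (tmapl T) (tmapl_linear T).
HB.instance Definition _ T :=
  GRing.isLinear.Build K _ _ *:%R (tmapr T) (tmapr_linear T).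

End Maps.

Section Associativity.
Context (M N U : lmodType K).

Let inner (m : M) : tensor N U -> tensor (tensor M N) U :=
  tensor_lift (fun n u => tens (tens m n) u).

Let inner_bilinear m :
  (forall u, linear (fun n => tens (tens m n) u : tensor (tensor M N) U)) /\
  (forall n, linear (fun u => tens (tens m n) u : tensor (tensor M N) U)).
Proof.
split=> [u|n] a x y; first by rewrite tens_linearr tens_linearl.
exact: tens_linearr.
Qed.

Let innerE m n u : inner m (tens n u) = tens (tens m n) u.
Proof. by have [? ?] := inner_bilinear m; rewrite /inner tensor_liftE. Qed.

Let inner_linearr m : linear (inner m).
Proof. by have [? ?] := inner_bilinear m; apply: tensor_lift_linear. Qed.

Let inner_linearl z : linear (inner^~ z).
Proof.
move=> a m m'; move: z; apply: tensor_lift_unique => [||n u].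
- exact: inner_linearr.
- move=> b x y; rewrite !inner_linearr !scalerDr !scalerA [b * a]mulrC.
  by rewrite addrACA.
- by rewrite !innerE tens_linearl tens_linearl.
Qed.

Definition tensorA : tensor M (tensor N U) -> tensor (tensor M N) U :=
  tensor_lift inner.

Fact tensorA_linear : linear tensorA.
Proof. exact: tensor_lift_linear. Qed.

HB.instance Definition _ :=
  GRing.isLinear.Build K _ _ *:%R tensorA tensorA_linear.

Lemma tensorAE m n u : tensorA (tens m (tens n u)) = tens (tens m n) u.
Proof. by rewrite /tensorA tensor_liftE. Qed.

(** No inverse of [tensorA] is constructed: to rebracket a nonzero vector it is enough to lift it,
    and a lift is automatically nonzero. *)
Lemma tensorA_surj w : exists z, tensorA z = w.
Proof.
have Timg (t : tensor M N) u : exists z, tensorA z = tens t u.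
  move: t; apply: tensor_span => [|m n];
    last by exists (tens m (tens n u)); rewrite tensorAE.
  split=> [|a x y [x' ex] [y' ey]]; first by exists 0; rewrite linear0 tens0l.
  by exists (a *: x' + y'); rewrite tensorA_linear ex ey tens_linearl.
move: w; apply: tensor_span => // ; split=> [|a x y [x' ex] [y' ey]].
  by exists 0; rewrite linear0.
by exists (a *: x' + y'); rewrite tensorA_linear ex ey.
Qed.

End Associativity.

(** The map [phi (x) id] followed by the identification of [K (x) N] with [N]. It serves to read off
    coordinates of tensors and to detect that they are nonzero. *)
Definition contract M N (phi : {linear M -> K^o}) : tensor M N -> N :=
  tensor_lift (fun m n => (phi m : K) *: n).

Fact contract_bilinear M N (phi : {linear M -> K^o}) :
  (forall n : N, linear (fun m => (phi m : K) *: n)) /\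
  (forall m, linear (fun n : N => (phi m : K) *: n)).
Proof.
split=> [n|m] a x y; first by rewrite linearP scalerDl scalerA.
by rewrite scalerDr !scalerA mulrC.
Qed.

Lemma contractE M N phi (m : M) (n : N) : contract phi (tens m n) = phi m *: n.
Proof. by have [? ?] := @contract_bilinear M N phi; rewrite /contract tensor_liftE. Qed.

Fact contract_linear M N phi : linear (@contract M N phi).
Proof. by have [? ?] := @contract_bilinear M N phi; apply: tensor_lift_linear. Qed.

HB.instance Definition _ M N phi :=
  GRing.isLinear.Build K _ _ *:%R (@contract M N phi) (contract_linear phi).

End TensorMaps.

(** * Modules on which the [L_m] act by exponential polynomials *)

Section ExponentialAction.
Context (K : numFieldType).

(** Allowing every cutoff [B'] beyond [B] lets two vectors share one cutoff. The threshold [N]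
    leaves room for a tensor factor on which [L m] vanishes only for large [m]. *)
Definition exponential_at (Z : lmodType K) (s : seq K) (L : nat -> Z -> Z)
    (X : K -> nat -> {linear Z -> Z}) (x : Z) : Prop :=
  exists N B, forall B', (B <= B')%N ->
    (forall a, a \in s -> X a B' x = 0) /\
    forall m, (N <= m)%N ->
      L m x = \sum_(a <- s) \sum_(k < B') (a ^+ m * m%:R ^+ k) *: X a k x.

Lemma exponential_at_subspace (Z : lmodType K) s L X :
  (forall m, linear (L m)) -> subspace (@exponential_at Z s L X).
Proof.
move=> L_lin; split=> [|a u v [N [B hu]] [N' [B' hv]]].
  exists 0%N, 0%N => B' _; split=> [a _|m _]; first by rewrite linear0.
  rewrite (linear_0 (L_lin m)) big1 // => a _.
  by rewrite big1 // => k _; rewrite linear0 scaler0.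
exists (maxn N N'), (maxn B B') => B''; rewrite geq_max => /andP[BB BB'].
have [Xu Lu] := hu _ BB; have [Xv Lv] := hv _ BB'; split=> [b bs|m].
  by rewrite linearP Xu // Xv // scaler0 addr0.
rewrite geq_max => /andP[Nm Nm']; rewrite L_lin Lu // Lv // scaler_sumr.
rewrite -big_split /=; apply: eq_bigr => b _; rewrite scaler_sumr.
rewrite -big_split /=; apply: eq_bigr => k _.
by rewrite linearP scalerDr !scalerA mulrC.
Qed.

Lemma exponential_at_stable (Z : lmodType K) (W : Z -> Prop) s L X r a k x :
  subspace W -> uniq s -> 0 \notin s -> exponential_at s L X x ->
  (forall m, (r <= m)%N -> W (L m x)) -> a \in s -> W (X a k x).
Proof.
move=> W_sub s_uniq s0 [N [B hx]] WL as_.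
(* The cutoff is raised to [B + k.+1] so that the index [k] lies below it in all cases. *)
have [_ hx'] := hx _ (leq_addr k.+1 B).
apply: (@exppoly_coef_mem _ _ W s (B + k.+1) (maxn N r) (fun a k => X a k x)) => //.
  by move=> m /andP[]; rewrite geq_max => /andP[Nm rm] _; rewrite -hx' //; exact: WL.
by rewrite addnS ltnS leq_addl.
Qed.

(* The quantification over the spectator space [U] is what makes this property
   pass to tensor products. *)
Definition absolutely_irreducible (M : lmodType K) (s : seq K)
    (X : K -> nat -> {linear M -> M}) : Prop :=
  forall (U : lmodType K) (W : tensor M U -> Prop), subspace W ->
    (forall a k w, a \in s -> W w -> W (tmapl (X a k) w)) ->
    (exists2 w, W w & w != 0) ->
  exists2 u : U, u != 0 & forall m, W (tens m u).

(** The third clause says that [M] is nonzero in a form suited to tensor products: contraction by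
    [phi] sends [tens x v] to [v]. *)
Definition exponential_module (s : seq K) (M : lieModType (virasoro K)) : Prop :=
  exists X : K -> nat -> {linear M -> M},
    [/\ forall x, exponential_at s (fun m x => lie_act (virL K m%:Z) x) X x,
        absolutely_irreducible s X
      & exists phi : {linear M -> K^o}, exists x, phi x = 1].

(** [L_m] acts by the Leibniz rule, so the two expansions are added and their lists of bases
    concatenated. An empty [s'] covers a factor whose vectors are each killed by [L_m] for large
    [m]. *)
Lemma tensor_exponential_at (M N : lieModType (virasoro K)) (s s' : seq K)
    (X : K -> nat -> {linear M -> M}) (Y : K -> nat -> {linear N -> N})
    (Z : K -> nat -> {linear tensor M N -> tensor M N}) :
  (forall a k, a \in s -> Z a k =1 tmapl (X a k)) ->
  (forall a k, a \in s' -> Z a k =1 tmapr (Y a k)) ->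
  (forall x, exponential_at s (fun m x => lie_act (virL K m%:Z) x) X x) ->
  (forall x, exponential_at s' (fun m x => lie_act (virL K m%:Z) x) Y x) ->
  forall x, exponential_at (s ++ s') (fun m x => lie_act (virL K m%:Z) x) Z x.
Proof.
move=> ZX ZY Xexp Yexp; apply: tensor_span.
  by apply: exponential_at_subspace => m; exact: lie_act_linearr.
move=> x y; have [A [B hx]] := Xexp x; have [A' [B' hy]] := Yexp y.
exists (maxn A A'), (maxn B B') => B''; rewrite geq_max => /andP[BB BB'].
have [Xx Lx] := hx _ BB; have [Yy Ly] := hy _ BB'; split=> [a|m].
  rewrite mem_cat => /orP[] as_.
    by rewrite ZX // tmaplE Xx // tens0l.
  by rewrite ZY // tmaprE Yy // tens0r.
rewrite geq_max => /andP[Am Am'].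
rewrite [lie_act _ _]tensor_actE /tens_act Lx // Ly // big_cat /=; congr (_ + _).
  rewrite tens_suml big_seq [RHS]big_seq; apply: eq_bigr => a as_.
  rewrite tens_suml; apply: eq_bigr => k _.
  by rewrite tensZl ZX // tmaplE.
rewrite tens_sumr big_seq [RHS]big_seq; apply: eq_bigr => a as_.
rewrite tens_sumr; apply: eq_bigr => k _.
by rewrite tensZr ZY // tmaprE.
Qed.

(** First [M] is used with the spectator [N (x) U], which gives [z != 0] such that [W] contains all
    of [M (x) z] after rebracketing. The set of such [z] is a subspace of [N (x) U] stable under the
    operators of [N], which is then used with the spectator [U]. *)
Lemma tensor_absolutely_irreducible (M N : lmodType K) (s s' : seq K)
    (X : K -> nat -> {linear M -> M}) (Y : K -> nat -> {linear N -> N})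
    (Z : K -> nat -> {linear tensor M N -> tensor M N}) :
  (forall a k, a \in s -> Z a k =1 tmapl (X a k)) ->
  (forall a k, a \in s' -> Z a k =1 tmapr (Y a k)) ->
  absolutely_irreducible s X -> absolutely_irreducible s' Y ->
  absolutely_irreducible (s ++ s') Z.
Proof.
move=> ZX ZY Xirr Yirr U W W_sub WZ [w Ww w0].
have AX a k z : a \in s ->
    tensorA (tmapl (X a k) z) = tmapl (Z a k) (tensorA z) :> tensor (tensor M N) U.
  move=> as_; move: z; apply: tensor_lift_unique => [||m t].
  - exact: linear_compose (tmapl_linear _) (@tensorA_linear _ _ _ _).
  - exact: linear_compose (@tensorA_linear _ _ _ _) (tmapl_linear _).
  move: t; apply: tensor_lift_unique => [||n u].
  - apply: linear_compose (@tensorA_linear _ _ _ _) => c x y.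
    by rewrite !tmaplE tens_linearr.
  - apply: linear_compose (tmapl_linear _).
    exact: linear_compose (tens_linearr _) (@tensorA_linear _ _ _ _).
  by rewrite tmaplE !tensorAE tmaplE ZX // tmaplE.
have AY a k z m : a \in s' ->
    tensorA (tens m (tmapl (Y a k) z)) = tmapl (Z a k) (tensorA (tens m z))
      :> tensor (tensor M N) U.
  move=> as_; move: z; apply: tensor_lift_unique => [||n u].
  - apply: linear_compose (@tensorA_linear _ _ _ _).
    exact: linear_compose (tmapl_linear _) (tens_linearr _).
  - apply: linear_compose (tmapl_linear _).
    exact: linear_compose (tens_linearr _) (@tensorA_linear _ _ _ _).
  by rewrite tmaplE !tensorAE tmaplE ZY // tmaprE.
have [z0 ez0] := tensorA_surj w.
have [|a k z as_ Wz||z z_neq0 Wz] := Xirr _ (fun z => W (tensorA z)).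
- exact: subspace_preim (@tensorA_linear _ _ _ _) W_sub.
- by rewrite AX //; apply: WZ; rewrite // mem_cat as_.
- exists z0; first by rewrite ez0.
  by apply: contraNneq w0 => z00; rewrite -ez0 z00 (linear_0 (@tensorA_linear K M N U)).
have [|a k t as_ Wt||u u0 Wu] := Yirr _ (fun z => forall m, W (tensorA (tens m z))).
- apply: subspace_forall => m; apply: subspace_preim W_sub.
  exact: linear_compose (tens_linearr _) (@tensorA_linear _ _ _ _).
- by move=> m; rewrite AY //; apply: WZ; rewrite // mem_cat as_ orbT.
- by exists z.
exists u => // t; move: t; apply: tensor_span => [|m n].
  exact: subspace_preim (@tens_linearl _ _ _ u) W_sub.
by rewrite -tensorAE; exact: Wu.
Qed.

Lemma tensor_exponential_module (s s' : seq K) (M N : lieModType (virasoro K)) :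
  uniq (s ++ s') -> exponential_module s M -> exponential_module s' N ->
  exponential_module (s ++ s') (tensor M N).
Proof.
rewrite cat_uniq => /and3P[_ /hasPn ss' _].
move=> [X [Xexp Xirr [phi [x phix]]]] [Y [Yexp Yirr [psi [y psiy]]]].
(* The two lists are disjoint, so the base [a] alone decides on which factor the operator acts. *)
pose Z a k : {linear tensor M N -> tensor M N} :=
  if a \in s then (tmapl (X a k) : {linear _ -> _}) else tmapr (Y a k).
have ZX a k : a \in s -> Z a k =1 tmapl (X a k) by move=> as_ z; rewrite /Z as_.
have ZY a k : a \in s' -> Z a k =1 tmapr (Y a k).
  by move=> /ss' /negbTE as_ z; rewrite /Z as_.
exists Z; split; first exact: tensor_exponential_at ZX ZY Xexp Yexp.
  exact: tensor_absolutely_irreducible ZX ZY Xirr Yirr.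
exists (psi \o contract phi : {linear _ -> _}), (tens x y).
by rewrite /= contractE phix scale1r psiy.
Qed.

End ExponentialAction.

(** * Iterates and locally nilpotent operators *)

Section IteratedMaps.
Context (K : fieldType).
Implicit Types M U : lmodType K.

Lemma iter_linear M (T : M -> M) n : linear T -> linear (iter n T).
Proof.
move=> Tlin; elim: n => [|n IHn] a x y //=.
by rewrite IHn Tlin.
Qed.

Lemma iter0_linear M (T : M -> M) n : linear T -> iter n T 0 = 0.
Proof. by move=> Tlin; apply: (linear_0 (iter_linear n Tlin)). Qed.

Definition locally_nilpotent M (T : M -> M) : Prop :=
  forall x, exists n, iter n T x = 0.

Lemma iter_eq0 M (T : M -> M) n m x : linear T ->
  (n <= m)%N -> iter n T x = 0 -> iter m T x = 0.
Proof.
by move=> Tlin nm Tx; rewrite -(subnK nm) iterD Tx iter0_linear.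
Qed.

Lemma tmapl_locally_nilpotent M U (T : {linear M -> M}) :
  locally_nilpotent T -> locally_nilpotent (@tmapl K M M U T).
Proof.
move=> Tnil; apply: tensor_span => [|m u].
  have Tlin := @tmapl_linear K M M U T.
  split=> [|a x y [n hx] [k hy]]; first by exists 0%N.
  exists (n + k)%N; rewrite iter_linear //.
  rewrite (iter_eq0 Tlin (leq_addr k n) hx) (iter_eq0 Tlin (leq_addl n k) hy).
  by rewrite scaler0 addr0.
have [n Tm] := Tnil m; exists n.
suff -> : iter n (tmapl T) (tens m u) = tens (iter n T m) u by rewrite Tm tens0l.
by elim: (n) => //= k ->; rewrite tmaplE.
Qed.

Lemma last_iterate M (T : M -> M) x : locally_nilpotent T -> x != 0 ->
  exists n, iter n T x != 0 /\ T (iter n T x) = 0.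
Proof.
move=> Tnil x0; have [n Tn] := Tnil x.
elim: n Tn => [|n IHn] /= Tn; first by rewrite Tn eqxx in x0.
by have [/IHn //|nz] := eqVneq (iter n T x) 0; exists n.
Qed.

(** [T ^ n] would multiply [x] by [c ^ n]. This gives the injectivity of [d/dt - c], also on tensor
    products. *)
Lemma nilpotent_no_eigenvector M (T : M -> M) c x : linear T ->
  locally_nilpotent T -> c != 0 -> T x = c *: x -> x = 0.
Proof.
move=> Tlin Tnil c0 Tx; have [n Tn] := Tnil x.
have Tk k : iter k T x = c ^+ k *: x.
  elim: k => [|k IHk] /=; first by rewrite scale1r.
  by rewrite IHk (linear_Z Tlin) Tx scalerA exprSr.
by move/eqP: Tn; rewrite Tk scaler_eq0 expf_eq0 (negbTE c0) andbF => /eqP.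
Qed.

Lemma tmapl_split M U (T Q D P D' : {linear M -> M}) :
  (forall m, T m = Q (D m) + P (D' m)) ->
  forall z : tensor M U, tmapl T z = tmapl Q (tmapl D z) + tmapl P (tmapl D' z).
Proof.
move=> TE; apply: tensor_lift_unique => [||m u].
- exact: tmapl_linear.
- move=> a x y; rewrite !tmapl_linear scalerDr addrACA //.
- by rewrite !tmaplE TE (linear_D (@tens_linearl K M U u)).
Qed.

End IteratedMaps.

(** * The modules [Phi] *)

Section PhiOperators.
Context (K : numFieldType).
Local Notation Kst := {mpoly K[2]}.
Local Notation "''s'" := ('X_(ord0 : 'I_2) : Kst) (at level 0).
Local Notation "''t'" := ('X_(ord_max : 'I_2) : Kst) (at level 0).

Definition d_ds (f : Kst) : Kst := mderiv ord0 f.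

Lemma d_ds_linear : linear d_ds.
Proof. by move=> a f g; rewrite /d_ds linearP. Qed.

Lemma d_dt_linear : linear (@d_dt K).
Proof. by move=> a f g; rewrite d_dtD d_dtZ. Qed.

HB.instance Definition _ := GRing.isLinear.Build K Kst Kst *:%R d_ds d_ds_linear.
HB.instance Definition _ := GRing.isLinear.Build K Kst Kst *:%R (@d_dt K) d_dt_linear.

Lemma d_dsM f g : d_ds (f * g) = d_ds f * g + f * d_ds g.
Proof. exact: mderivM. Qed.

Lemma d_ds_s : d_ds 's = 1.
Proof.
rewrite /d_ds mderivX mnm1E eqxx scale1r -[X in (X - _)%MM]add0m addmK.
exact: mpolyX0.
Qed.

Lemma d_ds_t : d_ds 't = 0.
Proof. by rewrite /d_ds mderivX mnm1E scale0r. Qed.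

Lemma d_ds1 : d_ds 1 = 0.
Proof. by rewrite /d_ds -mpolyC1 mderivC. Qed.

Lemma d_ds_d_dt f : d_ds (d_dt f) = d_dt (d_ds f).
Proof. exact: mderiv_comm. Qed.

Lemma mpoly2XE (m : 'X_{1..2}) : 'X_[m] = 's ^+ m ord0 * 't ^+ m ord_max :> Kst.
Proof.
rewrite mpolyXE_id big_ord_recl big_ord1; congr (_ * 'X_ _ ^+ m _); exact: val_inj.
Qed.

Lemma Kst_subspace (P : Kst -> Prop) : subspace P ->
  (forall i j, P ('s ^+ i * 't ^+ j)) -> forall f, P f.
Proof.
move=> P_sub PX f; rewrite (mpolyE f); apply: subspace_sum => // m _.
by apply: subspaceZ => //; rewrite mpoly2XE.
Qed.

Lemma Kst_subspace_ind (P : Kst -> Prop) : subspace P -> P 1 ->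
  (forall f, P f -> P ('s * f)) -> (forall f, P f -> P ('t * f)) -> forall f, P f.
Proof.
move=> P_sub P1 Ps Pt; apply: Kst_subspace => // i j.
elim: i => [|i IHi]; last by rewrite exprS -mulrA; apply: Ps.
by rewrite mul1r; elim: j => // j IHj; rewrite exprS; apply: Pt.
Qed.

Lemma iter_d_ds_s n f :
  iter n.+1 d_ds ('s * f) = 's * iter n.+1 d_ds f + n.+1%:R *: iter n d_ds f.
Proof.
elim: n => [|n IHn]; first by rewrite /= d_dsM d_ds_s mul1r addrC scale1r.
rewrite iterS IHn linearD linearZ /= d_dsM d_ds_s mul1r -addrA addrC -addrA.
by congr (_ + _); rewrite -[X in _ + X]scale1r -scalerDl natr1.
Qed.

Lemma iter_d_ds_t n f : iter n d_ds ('t * f) = 't * iter n d_ds f.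
Proof. by elim: n => //= n ->; rewrite d_dsM d_ds_t mul0r add0r. Qed.

(** The coefficient of [m ^ k] in the Taylor expansion of [f(s - m, t)] in powers of [m]. *)
Definition taylor k (f : Kst) : Kst := ((-1) ^+ k / k`!%:R) *: iter k d_ds f.

Lemma taylor0 f : taylor 0 f = f.
Proof. by rewrite /taylor fact0 divr1 scale1r. Qed.

Lemma taylor_linear k : linear (taylor k).
Proof.
move=> a f g; rewrite /taylor (iter_linear k d_ds_linear) scalerDr !scalerA.
by rewrite mulrC.
Qed.

Lemma taylor_s k f : taylor k.+1 ('s * f) = 's * taylor k.+1 f - taylor k f.
Proof.
rewrite /taylor iter_d_ds_s scalerDr scalerA scalerAr -scaleNr; congr (_ + _ *: _).
have k0 : k.+1%:R != 0 :> K by rewrite pnatr_eq0.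
have f0 : k`!%:R != 0 :> K by rewrite pnatr_eq0 -lt0n fact_gt0.
by rewrite factS natrM exprS; field; rewrite f0 addrC natr1.
Qed.

Lemma taylor_t k f : taylor k ('t * f) = 't * taylor k f.
Proof. by rewrite /taylor iter_d_ds_t scalerAr. Qed.

Definition taylor_at (f : Kst) : Prop :=
  exists B, forall B', (B <= B')%N -> iter B' d_ds f = 0 /\
    forall m : K, f \mPo [tuple 's - m%:MP; 't] = \sum_(k < B') m ^+ k *: taylor k f.

Lemma taylor_expansion f : taylor_at f.
Proof.
elim/Kst_subspace_ind: f => [||f [B hf]|f [B hf]].
- split=> [|a f g [B hf] [C hg]].
    exists 0%N => B' _; rewrite (iter0_linear _ d_ds_linear); split=> // m.
    by rewrite rmorph0 big1 // => k _; rewrite (linear_0 (taylor_linear k)) scaler0.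
  exists (maxn B C) => B'; rewrite geq_max => /andP[/hf[f0 fE] /hg[g0 gE]].
  split=> [|m]; first by rewrite (iter_linear _ d_ds_linear) f0 g0 scaler0 addr0.
  rewrite linearP /= fE gE scaler_sumr -big_split /=; apply: eq_bigr => k _.
  by rewrite taylor_linear scalerDr; congr (_ + _); rewrite scalerA mulrC -scalerA.
- exists 1%N => -[//|B'] _; rewrite iterSr.
  rewrite d_ds1 (iter0_linear _ d_ds_linear); split=> // m.
  rewrite rmorph1 big_ord_recl taylor0 scale1r big1 ?addr0 // => k _.
  by rewrite /taylor iterSr d_ds1 (iter0_linear _ d_ds_linear) !scaler0.
- exists B.+1 => -[//|B'] BB'; have [f0 fE] := hf B' BB'.
  have [f0' fE'] := hf B'.+1 (leqW BB').
  split=> [|m]; first by rewrite iter_d_ds_s f0 f0' mulr0 scaler0 addr0.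
  (* In [(s - m) f(s - m, t)] the factor [m] shifts the exponent by one, so [f] is expanded with
     cutoff [B'.+1] next to [s] and with cutoff [B'] next to [m]. *)
  rewrite rmorphM /= comp_mpolyXU mulrBl {1}fE' fE !big_ord_recl !taylor0 /=.
  rewrite !scale1r mulrDr !mulr_sumr -addrA; congr (_ + _).
  rewrite -sumrB; apply: eq_bigr => k _; rewrite taylor_s scalerBr scalerAr.
  by congr (_ - _); rewrite exprS -scalerA mul_mpolyC.
- exists B => B' /hf[f0 fE]; split=> [|m]; first by rewrite iter_d_ds_t f0 mulr0.
  rewrite rmorphM /= comp_mpolyXU fE mulr_sumr; apply: eq_bigr => k _.
  by rewrite taylor_t scalerAr.
Qed.

End PhiOperators.

(** * Coordinates of tensors with a polynomial factor *)

Section TensorPolynomials.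
Context (K : numFieldType).
Local Notation Kst := {mpoly K[2]}.
Local Notation "''s'" := ('X_(ord0 : 'I_2) : Kst) (at level 0).
Local Notation "''t'" := ('X_(ord_max : 'I_2) : Kst) (at level 0).

Lemma tmapl_iter (M U : lmodType K) (T I : {linear M -> M}) n :
  (forall m, I m = iter n T m) ->
  forall z : tensor M U, tmapl I z = iter n (tmapl T) z.
Proof.
move=> IE; apply: tensor_lift_unique => [||m u]; first exact: tmapl_linear.
  exact: iter_linear (tmapl_linear _).
by rewrite tmaplE IE; elim: (n) => //= k <-; rewrite tmaplE.
Qed.

Lemma mcoeff_linear m : linear (fun f : Kst => f@_m : K^o).
Proof. by move=> a f g; rewrite mcoeffD mcoeffZ. Qed.

Definition coef_form m : {linear Kst -> K^o} := linear_of (mcoeff_linear m).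

Lemma tensor_coefE (U : lmodType K) (z : tensor Kst U) :
  exists B, forall B', (B <= B')%N ->
    z = \sum_(m : 'X_{1..2 < B'}) tens 'X_[m] (contract (coef_form m) z).
Proof.
move: z; apply: tensor_span => [|f u].
  split=> [|a x y [B hx] [C hy]].
    exists 0%N => B' _; rewrite big1 // => m _.
    by rewrite (linear_0 (contract_linear _)) tens0r.
  exists (maxn B C) => B'; rewrite geq_max => /andP[/hx xE /hy yE].
  rewrite {1}xE {1}yE scaler_sumr -big_split /=; apply: eq_bigr => m _.
  by rewrite (contract_linear (coef_form m)) tens_linearr.
exists (msize f) => B' fB; rewrite {1}(mpolywE fB) tens_suml.
by apply: eq_bigr => m _; rewrite contractE tensZl tensZr.
Qed.

Lemma contract_coef_mderiv (U : lmodType K) i m (z : tensor Kst U) :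
  contract (coef_form m) (tmapl (mderiv i : {linear Kst -> Kst}) z)
    = (m i).+1%:R *: contract (coef_form (m + U_(i))%MM) z.
Proof.
move: z; apply: tensor_lift_unique => [||f u].
- exact: linear_compose (tmapl_linear _) (contract_linear _).
- exact: linear_scaled (contract_linear _).
- by rewrite tmaplE !contractE scalerA /= mcoeff_mderiv mulr_natl.
Qed.

(** For [m != 0] some [m i] is positive, and the coordinate of [z] at [m] times [m i] is a
    coordinate of the derivative of [z] in the variable [i]; in characteristic zero it vanishes. *)
Lemma tensor_const (U : lmodType K) (z : tensor Kst U) :
  (forall i, tmapl (mderiv i : {linear Kst -> Kst}) z = 0) ->
  z = tens 1 (contract (coef_form 0%MM) z).
Proof.
move=> dz; have coef0 (m : 'X_{1..2}) : m != 0%MM -> contract (coef_form m) z = 0.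
  move=> m0; have [i mi] : exists i, (0 < m i)%N.
    apply/existsP; apply: contraNT m0; rewrite negb_exists => /forallP m0.
    by apply/eqP/mnmP => i; rewrite mnm0E; apply/eqP; rewrite -leqn0 leqNgt.
  have := contract_coef_mderiv i (m - U_(i))%MM z.
  rewrite dz (linear_0 (contract_linear _)) submK; last first.
    by rewrite lep1mP -lt0n.
  by move/esym/eqP; rewrite scaler_eq0 pnatr_eq0 /= => /eqP.
(* A positive bound ensures that the zero multi-index is in the range of summation. *)
have [B /(_ B.+1 (leqnSn B)) {1}->] := tensor_coefE z.
rewrite (bigD1 bm0) //= mpolyX0 big1 ?addr0 // => m m0.
by rewrite coef0 ?tens0r //; apply: contraNneq m0 => m0; apply/eqP/val_inj.
Qed.

End TensorPolynomials.

(** * Expansion of [L_m] on [Phi] in powers of [m] *)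

Section PhiCoefficients.
Context (K : numFieldType) (al c d : K).
Local Notation Kst := {mpoly K[2]}.
Local Notation "''s'" := ('X_(ord0 : 'I_2) : Kst) (at level 0).
Local Notation "''t'" := ('X_(ord_max : 'I_2) : Kst) (at level 0).

(** For [h = c t + d] one has [g = c], and [L_m f] is [lam ^ m] times [s + m A + m ^ 2 al D] applied
    to [f(s - m, t)], with [A] and [D] the operators [Phi_A] and [Phi_D]. *)
Definition Phi_D (f : Kst) : Kst := d_dt f - c *: f.
Definition Phi_A (f : Kst) : Kst := (d + al * c) *: f - 't * Phi_D f.

Lemma Phi_D_linear : linear Phi_D.
Proof. exact/linear_shift/d_dt_linear. Qed.

Lemma Phi_A_linear : linear Phi_A.
Proof.
move=> a f g; rewrite /Phi_A Phi_D_linear mulrDr -scalerAr scalerDr scalerBr.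
by rewrite !scalerA [a * _]mulrC opprD addrACA.
Qed.

(* For [h = c t + d] the operator [L_m] of [Phi lam al h] is [lam^m] times the
   sum of the [m^k *: Phi_X k]. *)
Definition Phi_X (k : nat) (f : Kst) : Kst :=
  's * taylor k f +
  match k with
  | 0 => 0
  | k'.+1 => Phi_A (taylor k' f) +
      (if k' is k''.+1 then al *: Phi_D (taylor k'' f) else 0)
  end.

Lemma Phi_X_linear k : linear (Phi_X k).
Proof.
have sl j : linear (fun f => 's * taylor j f).
  by move=> a f g; rewrite taylor_linear mulrDr -scalerAr.
move=> a f g; rewrite /Phi_X; case: k => [|[|k]]; rewrite sl /= ?taylor_linear.
- by rewrite !addr0.
- by rewrite !addr0 Phi_A_linear [a *: ('s * _ + _)]scalerDr addrACA.
rewrite Phi_A_linear Phi_D_linear [a *: ('s * _ + _)]scalerDr.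
rewrite [a *: (Phi_A _ + _)]scalerDr [al *: (_ + _)]scalerDr !scalerA [al * a]mulrC.
by rewrite [X in _ + X]addrACA [LHS]addrACA.
Qed.

(** The product of the quadratic [s + mu A + mu ^ 2 al D] with the Taylor sum, sorted by powers of
    [mu]. The three cutoffs are staggered so that no boundary terms remain. *)
Lemma sum_Phi_X (mu : K) n f :
  \sum_(k < n.+2) mu ^+ k *: Phi_X k f =
    's * (\sum_(k < n.+2) mu ^+ k *: taylor k f)
    + mu *: Phi_A (\sum_(k < n.+1) mu ^+ k *: taylor k f)
    + (mu ^+ 2 * al) *: Phi_D (\sum_(k < n) mu ^+ k *: taylor k f).
Proof.
elim: n => [|n IHn].
  rewrite !big_ord_recr !big_ord0 /Phi_X /= !add0r expr0 !scale1r.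
  rewrite (linear_0 Phi_D_linear) scaler0 !addr0 expr1 scalerDr mulrDr.
  rewrite -!scalerAr -!mul_mpolyC; ring.
rewrite big_ord_recr IHn ![\sum_(k < n.+3) _]big_ord_recr.
rewrite [\sum_(k < n.+2) _ in X in _ = _ + X + _]big_ord_recr /=.
rewrite [\sum_(k < n.+1) _ in X in _ = _ + X]big_ord_recr /=.
rewrite (linear_D Phi_A_linear) (linear_D Phi_D_linear).
rewrite (linear_Z Phi_A_linear) (linear_Z Phi_D_linear) /Phi_X.
set a0 := \sum_(k < n.+2) _; set a1 := Phi_A (\sum_(k < n.+1) _).
set a2 := Phi_D (\sum_(k < n) _).
rewrite -!mul_mpolyC !mulrDr !(rmorphXn, rmorphM) /= !exprS; ring.
Qed.

Lemma Phi_L_expansion (lam : K) (h : {poly K}) f :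
  in_t h = c%:MP * 't + d%:MP -> in_t (divided_difference h al) = c%:MP ->
  exists B, forall B', (B <= B')%N ->
    Phi_X B' f = 0 /\ forall m : nat,
      Phi_L lam al h m%:Z f
        = \sum_(k < B') (lam ^+ m * m%:R ^+ k) *: Phi_X k f.
Proof.
move=> hE gE; have [B hB] := taylor_expansion f.
have tz k : (B <= k)%N -> taylor k f = 0.
  by move=> /hB[fz _]; rewrite /taylor fz scaler0.
(* The quadratic factor in [m] raises the degree of the Taylor sum by two. *)
exists B.+2 => -[|[|n]] // nB; split=> [|m].
  rewrite /Phi_X !tz //; try lia.
  by rewrite mulr0 (linear_0 Phi_A_linear) (linear_0 Phi_D_linear) scaler0 !addr0.
under eq_bigr do rewrite -scalerA.
rewrite -scaler_sumr sum_Phi_X /Phi_L -exprnP; congr (_ *: _).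
have mE : m%:Z%:~R = (m%:R)%:MP :> Kst by rewrite -pmulrn rmorph_nat.
rewrite /shift_s hE gE [m%:Z%:~R]mE.
have [_ /(_ m%:R) S1] := hB n.+2 (ltnW (ltnW nB)).
have [_ /(_ m%:R) S2] := hB n.+1 (ltnW nB).
have [_ /(_ m%:R) S3] := hB n nB.
rewrite -S1 -S2 -S3; set S := f \mPo _.
rewrite /Phi_A /Phi_D.
have -> : (m%:Z * (m%:Z - 1))%:~R = (m%:R)%:MP * ((m%:R)%:MP - 1) :> Kst.
  by rewrite rmorphM rmorphB /= mE.
rewrite -!mul_mpolyC !(mpolyCD, mpolyCM); ring.
Qed.

End PhiCoefficients.

(** * Absolute irreducibility of [Phi] *)

Section PhiIrreducible.
Context (K : numFieldType) (al c d : K).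
Hypotheses (al_neq0 : al != 0) (c_neq0 : c != 0).
Local Notation Kst := {mpoly K[2]}.
Local Notation "''s'" := ('X_(ord0 : 'I_2) : Kst) (at level 0).
Local Notation "''t'" := ('X_(ord_max : 'I_2) : Kst) (at level 0).
Local Notation X k := (linear_of (Phi_X_linear al c d k)).

Section Tensor.
Context (U : lmodType K).
Local Notation Ds := (@tmapl K Kst Kst U (@d_ds K : {linear _ -> _})).
Local Notation Dt := (@tmapl K Kst Kst U (@d_dt K : {linear _ -> _})).

(** All terms of [X p.+2] except the one with [Phi_D] factor through the power [p.+1] of [d_ds].
    Since [w] need not be an elementary tensor, this factorization is made for operators on
    polynomials and then carried over to the tensor product. *)
Lemma Phi_X_top p (w : tensor Kst U) : iter p.+1 Ds w = 0 ->
  tmapl (X p.+2) w =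
    ((-1) ^+ p / p`!%:R * al) *: (Dt (iter p Ds w) - c *: iter p Ds w).
Proof.
move=> Dw; pose k n : K := (-1) ^+ n / n`!%:R.
pose Q f : Kst := k p.+2 *: ('s * d_ds f) + k p.+1 *: Phi_A al c d f.
have Q_lin : linear Q.
  apply: linear_combination (Phi_A_linear al c d) => a f g.
  by rewrite d_ds_linear mulrDr -scalerAr.
pose P f : Kst := (k p * al) *: d_dt f + (- (k p * al * c)) *: f.
have id_lin (V : lmodType K) : linear (@id V) by [].
have P_lin : linear P := linear_combination (k p * al) _ (@d_dt_linear K) (id_lin _).
pose I n := linear_of (iter_linear n (@d_ds_linear K)).
rewrite (tmapl_split (Q := linear_of Q_lin) (D := I p.+1)
                     (P := linear_of P_lin) (D' := I p)); last first.
  move=> f /=; rewrite /Q /P /Phi_X /taylor -/(k p.+2) -/(k p.+1) -/(k p).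
  rewrite (linear_Z (Phi_A_linear al c d)) (linear_Z (Phi_D_linear c)) /Phi_D.
  rewrite -scalerAr -!mul_mpolyC !(mpolyCM, mpolyCN) /=; ring.
have IE n z : @tmapl K Kst Kst U (I n) z = iter n Ds z by apply: tmapl_iter.
rewrite !IE.
rewrite Dw (linear_0 (tmapl_linear _)) add0r; move: (iter p Ds w).
apply: tensor_lift_unique => [||f u]; first exact: tmapl_linear.
  exact/linear_scaled/linear_shift/tmapl_linear.
rewrite !tmaplE /= /P (linear_D (@tens_linearl _ _ _ u)) !tensZl scalerBr.
by rewrite scalerA scaleNr.
Qed.

End Tensor.

Lemma mderiv_locally_nilpotent i : locally_nilpotent (mderiv i : Kst -> Kst).
Proof.
have i_lin : linear (mderiv i : Kst -> Kst) by move=> a f g; rewrite linearP.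
have XN n (m : 'X_{1..2}) : (m i < n)%N -> iter n (mderiv i) ('X_[m] : Kst) = 0.
  elim: n m => // n IHn m mn; rewrite iterSr mderivX.
  rewrite (linear_Z (iter_linear n i_lin)); have [->|mi] := eqVneq (m i) 0%N.
    by rewrite scale0r.
  by rewrite IHn ?scaler0 // mnmBE mnm1E eqxx; lia.
move=> f; rewrite (mpolyE f); elim: (msupp f) => [|m r [n IHr]].
  by exists 0%N; rewrite big_nil.
exists (n + (m i).+1)%N; rewrite big_cons (iter_linear _ i_lin).
rewrite (iter_eq0 i_lin (leq_addr _ _) IHr) addr0.
by rewrite (iter_eq0 i_lin (leq_addl n _) (XN _ _ (ltnSn _))) scaler0.
Qed.

(** [Phi_X 0] is multiplication by [s], and [Phi_X 1] sends [t ^ j] to [c t ^ j.+1] plus a multiple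
    of [t ^ j], where [c != 0]. *)
Lemma mem_Kst (P : Kst -> Prop) : subspace P -> P 1 ->
  (forall k f, P f -> P (Phi_X al c d k f)) -> forall f, P f.
Proof.
move=> P_sub P1 PX; apply: Kst_subspace => // i j.
elim: i => [|i IHi]; last first.
  by have := PX 0%N _ IHi; rewrite /Phi_X taylor0 addr0 exprS mulrA.
rewrite mul1r; elim: j => // j IHj.
have dsX : d_ds ('t ^+ j) = 0 :> Kst.
  elim: (j) => [|k IHk]; first by rewrite d_ds1.
  by rewrite exprS d_dsM IHk d_ds_t mul0r mulr0 addr0.
have dtX : 't * d_dt ('t ^+ j) = j%:R *: 't ^+ j :> Kst.
  elim: (j) => [|k IHk]; first by rewrite expr0 -mpolyC1 d_dtC mulr0 scale0r.
  rewrite exprS d_dtM d_dt_t mul1r mulrDr IHk -scalerAr -exprS.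
  by rewrite -natr1 scalerDl scale1r addrC.
have := PX 1%N _ IHj; rewrite /Phi_X taylor0 /taylor /= dsX scaler0 mulr0 add0r addr0.
rewrite /Phi_A /Phi_D mulrBr dtX -scalerAr -exprS => PA.
apply: (subspaceZK P_sub c_neq0).
have -> : c *: 't ^+ j.+1 =
    (d + al * c) *: 't ^+ j - (j%:R *: 't ^+ j - c *: 't ^+ j.+1)
    + (j%:R - (d + al * c)) *: 't ^+ j.
  by rewrite scalerBl opprB addrA; ring.
by apply: subspaceD => //; apply: subspaceZ.
Qed.

Lemma Phi_absolutely_irreducible lam :
  absolutely_irreducible [:: lam] (fun _ k => X k).
Proof.
move=> U W W_sub WX [w Ww w0].
set Ds := @tmapl K Kst Kst U (@d_ds K : {linear _ -> _}).
set Dt := @tmapl K Kst Kst U (@d_dt K : {linear _ -> _}).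
have Ds_nil : locally_nilpotent Ds.
  exact: tmapl_locally_nilpotent (mderiv_locally_nilpotent ord0).
have Dt_nil : locally_nilpotent Dt.
  exact: tmapl_locally_nilpotent (mderiv_locally_nilpotent ord_max).
have Ds_lin : linear Ds := tmapl_linear _.
have Dt_lin : linear Dt := tmapl_linear _.
have DsDt z : Ds (Dt z) = Dt (Ds z).
  move: z; apply: tensor_lift_unique => [||f u]; try exact: linear_compose.
  by rewrite /Ds /Dt !tmaplE /= d_ds_d_dt.
have top p z : W z -> iter p.+1 Ds z = 0 -> W (Dt (iter p Ds z) - c *: iter p Ds z).
  move=> Wz Dz; have := WX lam p.+2 z (mem_head _ _) Wz; rewrite Phi_X_top //.
  apply: subspaceZK => //; rewrite !mulf_neq0 // ?expf_neq0 ?oppr_eq0 ?oner_eq0 //.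
  by rewrite invr_eq0 pnatr_eq0 -lt0n fact_gt0.
(* Here [p] is the degree of [w] in [s]. The vector [y] below lies in [W] by [top], is nonzero
   because [Dt - c] is injective, and is killed by [Ds]. *)
have [p [wp0 wp]] := last_iterate Ds_nil w0.
pose y := Dt (iter p Ds w) - c *: iter p Ds w.
have Wy : W y by apply: top.
have y0 : y != 0.
  apply: contraNneq wp0 => /subr0_eq.
  by move/(nilpotent_no_eigenvector Dt_lin Dt_nil c_neq0) => ->.
have Dy : Ds y = 0.
  rewrite /y addrC -scaleNr Ds_lin DsDt [Ds (iter _ _ _)]wp (linear_0 Dt_lin).
  by rewrite scaler0 addr0.
(* On vectors of [W] killed by [Ds], [top] at [p = 0] yields the image under [Dt - c]; adding back
   the multiple by [c] shows stability under [Dt]. *)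
have Wk k : W (iter k Dt y) /\ Ds (iter k Dt y) = 0.
  elim: k => [//|k [Wk Dk]]; rewrite iterS DsDt Dk (linear_0 Dt_lin); split=> //.
  have := top 0%N _ Wk Dk => /= Wt.
  have := subspaceD W_sub Wt (subspaceZ W_sub c Wk).
  by rewrite subrK.
have [q [yq0 yq]] := last_iterate Dt_nil y0.
have [Wq Dq] := Wk q.
set z := iter q Dt y in Wq Dq yq0 yq.
(* The last nonzero iterate of [Dt] on [y] is killed by both derivatives, hence constant in [s] and
   [t]. *)
have zE : z = tens 1 (contract (coef_form K 0%MM) z).
  apply: tensor_const => i; have [->|->] : i = ord0 \/ i = ord_max.
  - by case: i => [[|[|//]]] lt_i; [left|right]; apply: val_inj.
  - exact: Dq.
  - exact: yq.
exists (contract (coef_form K 0%MM) z).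
  by apply: contraNneq yq0 => u0; rewrite zE u0 tens0r.
apply: mem_Kst => [||k f Wf].
- exact: subspace_preim (@tens_linearl _ _ _ _) W_sub.
- by rewrite -zE.
- by have := WX lam k _ (mem_head _ _) Wf; rewrite tmaplE.
Qed.

End PhiIrreducible.

Lemma Phi_exponential_module (K : numFieldType) (lam al : K) (h : {poly K})
    (lam0 : lam != 0) : al != 0 -> size h = 2%N ->
  exponential_module [:: lam] (Phi al h lam0).
Proof.
move=> al0 size_h; set c := h`_1; set d := h`_0.
have c0 : c != 0.
  by rewrite /c -[1%N]/(2.-1) -size_h lead_coef_eq0 -size_poly_gt0 size_h.
have hE : h = c *: 'X + d%:P.
  apply/polyP => -[|[|i]]; rewrite !coefE ?mulr0 ?add0r ?mulr1 ?addr0 //=.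
  by rewrite nth_default ?size_h // mulr0.
have hE' : in_t h = c%:MP * 'X_(ord_max : 'I_2) + d%:MP.
  by rewrite hE -mul_polyC in_tD in_tM !in_tC in_tX.
have gE : in_t (divided_difference h al) = c%:MP.
  rewrite -in_tC /divided_difference; congr in_t.
  have -> : h - h.[al]%:P = c%:P * ('X - al%:P).
    rewrite hE !hornerE -mul_polyC polyCD polyCM; ring.
  by rewrite mulpK // polyXsubC_eq0.
exists (fun _ k => linear_of (Phi_X_linear al c d k)); split.
- move=> f; have [B hB] := Phi_L_expansion lam f hE' gE.
  exists 0%N, B => B' /hB[Xz LE]; split=> [a _|m _]; first exact: Xz.
  by rewrite [lie_act _ _]Phi_actU [LHS]LE big_seq1.
- exact: Phi_absolutely_irreducible.
- exists (coef_form K 0%MM), (1 : {mpoly K[2]}).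
  by rewrite /= mcoeff1 eqxx.
Qed.

(** * Locally finite operators *)

Section OperatorPolynomials.
Context (K : fieldType) (V : lmodType K) (T : V -> V) (T_lin : linear T).
Implicit Types (p q : {poly K}) (v : V).

Definition oppoly q v : V := \sum_(i < size q) q`_i *: iter i T v.

Lemma oppoly_wide B q v : (size q <= B)%N ->
  oppoly q v = \sum_(i < B) q`_i *: iter i T v.
Proof.
move=> qB; rewrite /oppoly (big_ord_widen B (fun i => q`_i *: iter i T v) qB).
rewrite big_mkcond; apply: eq_bigr => i _; case: ltnP => // qi.
by rewrite nth_default ?scale0r.
Qed.

Lemma oppoly_linear q : linear (oppoly q).
Proof.
move=> a u v; rewrite /oppoly scaler_sumr -big_split; apply: eq_bigr => i _ /=.
by rewrite (iter_linear i T_lin) scalerDr !scalerA mulrC.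
Qed.

Lemma oppolyDMX p c v : oppoly (p * 'X + c%:P) v = oppoly p (T v) + c *: v.
Proof.
rewrite (@oppoly_wide (size p).+1) ?size_MXaddC; last by case: ifP.
rewrite big_ord_recl /= coefD coefMX coefC /= add0r addrC; congr (_ + _).
apply: eq_bigr => i _; rewrite coefD coefMX coefC /= addr0.
by rewrite -iterSr.
Qed.

Lemma oppolyC c v : oppoly c%:P v = c *: v.
Proof.
rewrite -[c%:P]add0r -(mul0r 'X) oppolyDMX /oppoly size_poly0 big_ord0 add0r //.
Qed.

Lemma oppolyD p q v : oppoly (p + q) v = oppoly p v + oppoly q v.
Proof.
rewrite (@oppoly_wide (maxn (size p) (size q)) (p + q)) ?size_polyD //.
rewrite (oppoly_wide v (leq_maxl (size p) (size q))).
rewrite (oppoly_wide v (leq_maxr (size p) (size q))) -big_split.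
by apply: eq_bigr => i _; rewrite coefD scalerDl.
Qed.

Lemma oppolyCM c p v : oppoly (c%:P * p) v = c *: oppoly p v.
Proof.
have [->|c0] := eqVneq c 0.
  by rewrite mul0r scale0r -[0]/(0%:P) oppolyC scale0r.
rewrite /oppoly mul_polyC size_scale // scaler_sumr.
by apply: eq_bigr => i _; rewrite coefZ scalerA.
Qed.

Lemma oppolyM p q v : oppoly (p * q) v = oppoly p (oppoly q v).
Proof.
elim/poly_ind: q v => [|q c IHq] v.
  by rewrite mulr0 -[0]/(0%:P) !oppolyC !scale0r (linear_0 (oppoly_linear p)).
rewrite mulrDr mulrA oppolyD mulrC [p * _%:P]mulrC oppolyCM oppolyDMX.
rewrite (linear_D (oppoly_linear p)) (linear_Z (oppoly_linear p)); congr (_ + _).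
by rewrite mulrC -[X in oppoly X]addr0 -[0]/(0%:P) oppolyDMX scale0r addr0.
Qed.

Lemma oppoly_iter p v n : oppoly p (iter n T v) = iter n T (oppoly p v).
Proof.
have pT u : oppoly p (T u) = T (oppoly p u).
  have := oppolyM 'X p u; have := oppolyM p 'X u.
  have oX w : oppoly 'X w = T w.
    rewrite -['X]mul1r -[1]/(1%:P) -[_ * 'X]addr0 oppolyDMX oppolyC.
    by rewrite scale1r scale0r addr0.
  by rewrite !oX mulrC => -> <-.
by elim: n => //= n IHn; rewrite pT IHn.
Qed.

(** The [n.+1] vectors [iter i T v] with [i <= n] lie in the span of [n] vectors, so a nonzero row
    in the left kernel of a matrix of coordinates is a relation among them. The family [e] may be
    dependent, so coordinates are chosen. *)
Lemma locally_finite_annihilator v : locally_finite T ->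
  exists2 q, q != 0 & oppoly q v = 0.
Proof.
move=> /(_ v)[W [_ [e We] Wv WT]]; set n := size e.
have Wi i : W (iter i T v) by elim: i => //= i; apply: WT.
have coords u : W u -> exists r : 'rV[K]_n, u = \sum_j r 0 j *: e`_j.
  pose R w := exists r : 'rV[K]_n, w = \sum_j r 0 j *: e`_j.
  move/We; apply: (span_min (W := R)) => [|w we].
    split=> [|a x y [r ->] [r' ->]].
      by exists 0; rewrite big1 // => j _; rewrite mxE scale0r.
    exists (a *: r + r'); rewrite scaler_sumr -big_split; apply: eq_bigr => j _ /=.
    by rewrite !mxE scalerDl scalerA.
  have ie : (index w e < n)%N by rewrite index_mem.
  exists (delta_mx 0 (Ordinal ie)); rewrite (bigD1 (Ordinal ie)) //= big1 => [|j ji].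
    by rewrite mxE !eqxx scale1r addr0 nth_index.
  by rewrite mxE (negbTE ji) andbF scale0r.
have [r rE] := choice (fun i => coords _ (Wi i)).
pose A : 'M[K]_(n.+1, n) := \matrix_(i, j) r i 0 j.
have : kermx A != 0.
  rewrite kermx_eq0 -row_leq_rank; apply: contraL (rank_leq_col A) => rA.
  by rewrite -ltnNge.
move=> /rowV0Pn[u /sub_kermxP uA u0]; exists (rVpoly u).
  by apply: contraNneq u0 => u0; rewrite -[u]rVpolyK u0 linear0.
rewrite (@oppoly_wide n.+1) ?size_poly //.
under eq_bigr => i _ do rewrite coef_rVpoly_ord rE scaler_sumr.
rewrite exchange_big big1 // => j _.
have /matrixP/(_ 0 j) := uA; rewrite !mxE => uAj.
under eq_bigr do rewrite scalerA.
rewrite -scaler_suml (_ : \sum_i _ = 0) ?scale0r // -[RHS]uAj.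
by apply: eq_bigr => i _; rewrite mxE.
Qed.

End OperatorPolynomials.

(** For a root [a] of [q], either [v] is an eigenvector for [a], or [T v - a *: v] is a nonzero
    vector killed by the quotient of [q] by ['X - a], of smaller degree. *)
Lemma annihilated_eigenvector (K : closedFieldType) (V : lmodType K) (T : V -> V)
    (q : {poly K}) (v : V) : linear T -> q != 0 -> v != 0 -> oppoly T q v = 0 ->
  exists a u, u != 0 /\ T u = a *: u.
Proof.
move=> T_lin; have [n] := ubnP (size q); elim: n q v => // n IHn q v qn q0 v0 qv.
have [q1|q1] := eqVneq (size q) 1%N.
  have [c c0 qE] := size_poly1P _ (introT eqP q1).
  move: qv; rewrite qE oppolyC => /eqP.
  by rewrite scaler_eq0 (negbTE c0) (negbTE v0).
have [a /factor_theorem[p pE]] := closed_rootP q q1.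
have p0 : p != 0 by apply: contraNneq q0 => p0; rewrite pE p0 mul0r.
have [Ta|Ta] := eqVneq (T v - a *: v) 0.
  by exists a, v; split=> //; apply: subr0_eq.
apply: (IHn p (T v - a *: v)) => //.
  by move: qn; rewrite pE size_Mmonic ?monicXsubC // size_XsubC addn2.
rewrite -qv pE oppolyM //; congr (oppoly _ _ _).
rewrite -['X - _]/('X + _) -polyCN -['X in RHS]mul1r oppolyDMX -[1]/(1%:P) oppolyC.
by rewrite scale1r scaleNr.
Qed.

(** * Vectors annihilated by [L_m] for large [m] *)

Section SmoothVectors.
Context (K : numFieldType) (V : lieModType (virasoro K)).
Local Notation L m v := (lie_act (virL K m) (v : V) : V).

Definition smooth (v : V) : Prop :=
  exists N : nat, forall m : nat, (N <= m)%N -> L m%:Z v = 0.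

Lemma virL_commutator (m n : int) v : m + n != 0 ->
  L m (L n v) = L n (L m v) + (n - m)%:~R *: L (m + n) v.
Proof.
move=> mn; apply/eqP; rewrite addrC -subr_eq; apply/eqP.
rewrite -lie_act_bracket [lie_bracket _ _]vir_bracketU /= (negbTE mn) scale0r addr0.
exact: (linear_Z (lie_act_linearl v)).
Qed.

(** * Eigenvectors of [L_n] with [n > 0] *)

Section Eigenvector.
Context (n : nat) (lambda : K) (v : V) (q : {poly K}).
Hypotheses (n_gt0 : (0 < n)%N) (Lv : L n%:Z v = lambda *: v) (q_neq0 : q != 0).
(** Because [L_n v = lambda v], the operator [T] sends [L_j v] to [[L_n, L_j] v]: on the vectors
    [u j] it is [ad L_n]. *)
Let T (x : V) : V := L n%:Z x - lambda *: x.
Hypothesis qT : forall j : nat, (n < j)%N -> oppoly T q (L j%:Z v) = 0.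
Let u (j : nat) : V := L j%:Z v.

Let T_linear : linear T.
Proof. exact/linear_shift/lie_act_linearr. Qed.

Let Tu (j : nat) : T (u j) = (j%:R - n%:R) *: u (j + n).
Proof.
rewrite /T /u virL_commutator; last by apply/eqP; lia.
rewrite Lv (linear_Z (lie_act_linearr _)) addrAC subrr add0r -PoszD addnC.
by rewrite rmorphB.
Qed.

(** Its value at [j] is the product of the factors [j + l n - n] that [T] picks up on its way from
    [u j] to [u (j + i * n)]. *)
Let pp (i : nat) : {poly K} := \prod_(l < i) ('X - ((1 - l%:R) * n%:R)%:P).

Let iterTu i j : iter i T (u j) = (pp i).[j%:R] *: u (j + i * n).
Proof.
elim: i => [|i IHi]; first by rewrite /pp big_ord0 hornerC scale1r addn0.
rewrite /= IHi (linear_Z T_linear) Tu scalerA /pp big_ord_recr /= hornerM.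
rewrite hornerXsubC natrD natrM mulSn addnCA [(n + _)%N]addnC; congr (_ * _ *: _).
ring.
Qed.

Let pp_monic i : pp i \is monic.
Proof. by apply: monic_prod => l _; exact: monicXsubC. Qed.

Let size_pp i : size (pp i) = i.+1.
Proof.
elim: i => [|i IHi]; first by rewrite /pp big_ord0 size_poly1.
rewrite /pp big_ord_recr /= -/(pp i) size_Mmonic ?monicXsubC ?monic_neq0 //.
by rewrite IHi size_XsubC addn2.
Qed.

Let d := (size q).-1.
Let c i (j : nat) : K := q`_i * (pp i).[j%:R].

Let relation j : (n < j)%N -> \sum_(i < d.+1) c i j *: u (j + i * n) = 0.
Proof.
move=> /qT qj; rewrite -[RHS]qj (@oppoly_wide _ _ _ d.+1); last exact: leqSpred.
by apply: eq_bigr => i _; rewrite [iter _ _ _]iterTu scalerA.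
Qed.

(** The combination of the [L_(j + i n)] with coefficients [c i j] is applied to the relation at
    [k], and symmetrically. In the difference of the two each pair of products is a commutator,
    [[L_a, L_b] v = (b - a) u (a + b)]. *)
Let bracket_relation j k : (n < j)%N -> (n < k)%N ->
  \sum_(i < d.+1) \sum_(i' < d.+1)
    (c i j * c i' k * ((k + i' * n)%:R - (j + i * n)%:R)) *: u (j + k + (i + i') * n)
  = 0.
Proof.
move=> nj nk; pose LL a b := L a%:Z (u b).
have L_sum m (I : finType) (F : I -> K) (x : I -> V) :
    L m (\sum_i F i *: x i) = \sum_i F i *: L m (x i).
  have Lm := lie_act_linearr (virL K m) : linear (fun x : V => L m x).
  rewrite (big_morph _ (linear_D Lm) (linear_0 Lm)); apply: eq_bigr => i _.
  exact: (linear_Z Lm).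
have S1 : \sum_(i < d.+1) \sum_(i' < d.+1)
    (c i j * c i' k) *: LL (j + i * n)%N (k + i' * n)%N = 0.
  rewrite big1 // => i _; under eq_bigr do rewrite -scalerA.
  by rewrite -scaler_sumr -L_sum relation // (linear_0 (lie_act_linearr _)) scaler0.
have S2 : \sum_(i < d.+1) \sum_(i' < d.+1)
    (c i j * c i' k) *: LL (k + i' * n)%N (j + i * n)%N = 0.
  rewrite exchange_big big1 // => i' _.
  under eq_bigr do rewrite [c _ _ * _]mulrC -scalerA.
  by rewrite -scaler_sumr -L_sum relation // (linear_0 (lie_act_linearr _)) scaler0.
have S12 := congr2 (fun x y : V => x - y) S1 S2.
rewrite -[RHS]subr0 -[RHS]S12 /= -sumrB; apply: eq_bigr => i _.
rewrite -sumrB; apply: eq_bigr => i' _.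
rewrite -scalerBr -scalerA /LL /u; congr (_ *: _).
rewrite [in RHS]virL_commutator; last by apply/eqP; lia.
rewrite addrAC subrr add0r -PoszD rmorphB /=; congr (_ *: L _ _).
by congr (Posz _); lia.
Qed.

(* The top coefficient in [j] of [bracket_relation] at [k = N - j] involves only
   the term [i = i' = d]. *)
Let eventually0 N : (2 * n + 2 * d + 4 <= N)%N -> u (N + 2 * d * n) = 0.
Proof.
move=> Nbig.
(* The variable ['X] stands for [j], with [k = N - j]: [C] is the factor coming from the commutator
   and [Q] the whole coefficient of [u (N + (i + i') * n)]. *)
pose C (i i' : nat) : {poly K} := (N%:R + i'%:R * n%:R - i%:R * n%:R)%:P - 2%:R *: 'X.
pose Q (i i' : nat) : {poly K} :=
  (q`_i * q`_i') *: (pp i * (pp i' \Po (N%:R%:P - 'X)) * C i i').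
have size_refl : size (N%:R%:P - 'X : {poly K}) = 2%N.
  by rewrite -opprB size_polyN size_XsubC.
have size_comp i : size (pp i \Po (N%:R%:P - 'X)) = i.+1.
  by rewrite size_comp_poly2 // size_pp.
have CE i i' : C i i' = (- 2%:R) *: 'X + (N%:R + i'%:R * n%:R - i%:R * n%:R)%:P.
  by rewrite /C scaleNr addrC.
have two0 : - 2%:R != 0 :> K by rewrite oppr_eq0 pnatr_eq0.
have sizeC i i' : size (C i i') = 2%N.
  by rewrite CE -mul_polyC size_MXaddC polyC_eq0 (negbTE two0) /= size_polyC two0.
have sizeQ i i' : (size (Q i i') <= i + i' + 2)%N.
  rewrite /Q; apply: leq_trans (size_scale_leq _ _) _.
  apply: leq_trans (size_polyMleq _ _) _; rewrite sizeC.
  have := size_polyMleq (pp i) (pp i' \Po (N%:R%:P - 'X)).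
  by rewrite size_comp size_pp; lia.
pose z k : V := \sum_(i < d.+1) \sum_(i' < d.+1) (Q i i')`_k *: u (N + (i + i') * n).
(* The vectors [u (N + (i + i') * n)] do not depend on [j], so the relation is an exponential
   polynomial with the single base [1] and its coefficients [z k] vanish. The bound on [N] keeps
   both [m] and [N - m] above [n] at all sampled [m]. *)
have z0 : z (2 * d).+1 = 0.
  apply: (@exppoly_coef_mem K V (fun x => x = 0) [:: 1] (2 * d).+2 n.+1
            (fun _ k => z k) _ _ _ _ 1) => //.
  - by split=> // a x y -> ->; rewrite scaler0 addr0.
  - by rewrite inE eq_sym oner_eq0.
  - move=> m /andP[nm]; rewrite mul1n big_seq1 /= => mN.
    rewrite -[RHS](bracket_relation (j := m) (k := N - m)); try lia.
    rewrite /z; under eq_bigr do rewrite scaler_sumr.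
    rewrite exchange_big /=; apply: eq_bigr => i _.
    under eq_bigr do rewrite scaler_sumr.
    rewrite exchange_big /=; apply: eq_bigr => i' _.
    rewrite subnKC; last lia.
    under eq_bigr do rewrite scalerA expr1n mul1r mulrC.
    rewrite -scaler_suml; congr (_ *: _).
    rewrite -(horner_coef_wide (n := (2 * d).+2)); last first.
      by apply: leq_trans (sizeQ _ _) _; have := ltn_ord i; have := ltn_ord i'; lia.
    rewrite /Q /C /c hornerZ !hornerM horner_comp.
    rewrite !(hornerD, hornerN, hornerZ, hornerC, hornerX).
    rewrite !natrD !natrM natrB; [ring|lia].
  - exact: mem_head.
have := z0; rewrite /z (bigD1 ord_max) //= (bigD1 ord_max) //= !big1 ?addr0.
- rewrite addnn -mul2n => /eqP; rewrite scaler_eq0 => /orP[|/eqP //].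
  have d0 : q`_d != 0 by rewrite -lead_coefE lead_coef_eq0.
  have sizeP : size (pp d * (pp d \Po (N%:R%:P - 'X)) * C d d) = (2 * d).+2.
    rewrite size_mul ?mulf_neq0 -?size_poly_gt0 ?sizeC ?size_comp ?size_pp //.
    by rewrite size_mul -?size_poly_gt0 ?size_comp ?size_pp //; lia.
  rewrite /Q coefZ !mulf_eq0 (negbTE d0) /= -[(2 * d).+1]/((2 * d).+2.-1) -sizeP.
  rewrite -lead_coefE lead_coef_eq0 -size_poly_eq0 sizeP //.
- move=> i iN; rewrite big1 // => i' _.
  rewrite nth_default ?scale0r //; apply: leq_trans (sizeQ _ _) _.
  have : (i : nat) != d by apply: contraNneq iN => id; apply/eqP/val_inj.
  by have := ltn_ord i; have := ltn_ord i'; lia.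
- move=> i iN; rewrite nth_default ?scale0r //; apply: leq_trans (sizeQ _ _) _.
  have : (i : nat) != d by apply: contraNneq iN => id; apply/eqP/val_inj.
  by have := ltn_ord i; lia.
Qed.

Lemma eigenvector_smooth : smooth v.
Proof.
exists (2 * n + 2 * d + 4 + 2 * d * n)%N => m mN.
have -> : m = (m - 2 * d * n + 2 * d * n)%N by rewrite subnK //; lia.
by apply: eventually0; lia.
Qed.

End Eigenvector.

Lemma smooth_submodule : submodule_over (fun _ => True) smooth.
Proof.
have s_sub : subspace smooth.
  split=> [|a x y [N hx] [N' hy]];
    first by exists 0%N => m _; apply: (linear_0 (lie_act_linearr _)).
  exists (maxn N N') => m; rewrite geq_max => /andP[/hx xm /hy ym].
  by rewrite lie_act_linearr xm ym scaler0 addr0.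
split=> // x v _ [N vN]; move: x; apply: freeg_span.
  exact: subspace_preim (lie_act_linearl v) s_sub.
move=> [k|]; last first.
  exists N => m /vN Lv; have := lie_act_bracket (virL K m%:Z) (virC K) v.
  rewrite [lie_bracket _ _]vir_bracketU /= Lv (linear_0 (lie_act_linearl v)).
  by rewrite (linear_0 (lie_act_linearr _)) subr0.
(* This bound makes [m + k] positive and at least [N]: there is no central term, and both [L_m] and
   [L_(m + k)] kill [v]. *)
exists (N + absz k + 1)%N => m mN.
change (L m%:Z (L k v) = 0).
rewrite virL_commutator; last by apply/eqP; lia.
rewrite vN; last lia.
have -> : m%:Z + k = (absz (m%:Z + k))%:Z by lia.
by rewrite vN ?scaler0 ?(linear_0 (lie_act_linearr _)) ?addr0 //; lia.
Qed.

End SmoothVectors.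

Lemma irreducible_smooth (K : numClosedFieldType) (V : lieModType (virasoro K)) :
  irreducible V ->
  (exists RV : nat, forall k : int, RV%:Z <= k ->
    locally_finite (fun v : V => lie_act (virL K k) v)) ->
  forall v : V, smooth v.
Proof.
move=> [[v0 v0_neq0] V_irr] [RV V_lf].
have [smooth0|//] := V_irr _ (smooth_submodule V).
pose n := RV.+1.
have L_lin : linear (fun v : V => lie_act (virL K n%:Z) v) := lie_act_linearr _.
have L_lf : locally_finite (fun v : V => lie_act (virL K n%:Z) v) by apply: V_lf; lia.
have [q q0 qv0] := locally_finite_annihilator v0 L_lf.
have [a [v [v_neq0 Lv]]] := annihilated_eigenvector L_lin q0 v0_neq0 qv0.
pose T (x : V) := lie_act (virL K n%:Z) x - a *: x.
have T_lin : linear T := linear_shift a L_lin.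
have T_lf : locally_finite T.
  move=> x; have [W [W_sub Wfin Wx WL]] := L_lf x; exists W; split=> // y Wy.
  by apply: subspaceB => //; [apply: WL | apply: subspaceZ].
(* A product of finitely many annihilators handles [j] up to [2 n]. For larger [j], the vector
   [L_j v] is a multiple of [T (L_(j - n) v)], since the factor [j - 2 n] is nonzero, and so has the
   same annihilator. *)
have [p p0 pT] : exists2 p : {poly K}, p != 0 & forall j, (n < j <= n + n)%N ->
    oppoly T p (lie_act (virL K j%:Z) v) = 0.
  have annih j := locally_finite_annihilator (lie_act (virL K j%:Z) v) T_lf.
  suff [p p0 pT] : exists2 p : {poly K}, p != 0 & forall j, (j < (n + n).+1)%N ->
      oppoly T p (lie_act (virL K j%:Z) v) = 0.
    by exists p => // j /andP[_]; exact: pT.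
  elim: (n + n).+1 => [|k [p p0 pT]]; first by exists 1; rewrite ?oner_neq0.
  have [r r0 rT] := annih k; exists (p * r); first by rewrite mulf_neq0.
  move=> j; rewrite ltnS leq_eqVlt => /orP[/eqP->|jk].
    by rewrite oppolyM // rT (linear_0 (oppoly_linear T_lin p)).
  by rewrite mulrC oppolyM // pT // (linear_0 (oppoly_linear T_lin r)).
have pT' j : (n < j)%N -> oppoly T p (lie_act (virL K j%:Z) v) = 0.
  have [k] := ubnP j; elim: k j => // k IHk j jk nj.
  have [jn|jn] := leqP j (n + n); first by apply: pT; rewrite nj.
  have Tj : T (lie_act (virL K (j - n)%N%:Z) v)
      = (j - n - n)%N%:R *: lie_act (virL K j%:Z) v.
    rewrite /T virL_commutator; last by apply/eqP; lia.
    rewrite Lv (linear_Z (lie_act_linearr _)) addrAC subrr add0r.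
    by congr (_ *: lie_act (virL K _) v); rewrite ?pmulrn; try congr (_%:~R); lia.
  have jn0 : (j - n - n)%N%:R != 0 :> K by rewrite pnatr_eq0; lia.
  have := congr1 (oppoly T p) Tj; rewrite (linear_Z (oppoly_linear T_lin p)).
  rewrite -[T _]/(iter 1 T _) oppoly_iter // IHk; try lia.
  rewrite [iter 1 _ _]/= (linear_0 T_lin) => /esym/eqP.
  by rewrite scaler_eq0 (negbTE jn0) => /eqP.
by case/eqP: v_neq0; apply: smooth0; apply: eigenvector_smooth Lv p0 pT'; lia.
Qed.

(** * From absolute irreducibility to irreducibility *)

Section Irreducibility.
Context (K : numFieldType) (s : seq K) (M : lieModType (virasoro K)).
Hypotheses (s_uniq : uniq s) (s_neq0 : 0 \notin s) (M_exp : exponential_module s M).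

Lemma subspace_dichotomy (Z : lmodType K) (W : Z -> Prop) :
  ((exists2 w, W w & w != 0) -> forall z, W z) ->
  (forall z, W z -> z = 0) \/ forall z, W z.
Proof.
move=> H; have [/H|W0] := EM (exists2 w, W w & w != 0); [by right | left].
by move=> z Wz; apply/eqP/negPn/negP => z0; apply: W0; exists z.
Qed.

Lemma virL_gt r m : (r < m)%N -> vir_gt r (virL K m%:Z).
Proof. by move=> rm; apply: span_incl; exists m%:Z. Qed.

(** The operators [X a k] are recovered from the [L_m] with [m > r] alone. Absolute irreducibility
    is applied with the spectator [K], and [tensor_lift f] below is the map from [M (x) K] to [M]
    that transports [W]. *)
Lemma exponential_module_irreducible r : irreducible_over (@vir_gt K r) M.
Proof.
have [X [Xexp Xirr [phi [x phix]]]] := M_exp.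
split=> [|W [W_sub WL]].
  exists x; apply: contra_eq_neq phix => ->.
  by rewrite linear0 eq_sym oner_neq0.
apply: subspace_dichotomy => -[w Ww w0].
have WX a k y : a \in s -> W y -> W (X a k y).
  move=> as_ Wy.
  apply: (exponential_at_stable k W_sub s_uniq s_neq0 (Xexp y) (r := r.+1)) => //.
  by move=> m rm; apply: WL => //; apply: virL_gt.
pose f (m : M) (a : K^o) : M := (a : K) *: m.
have fl (a : K^o) : linear (f^~ a) by move=> b y z; rewrite /f scalerDr !scalerA mulrC.
have fr m : linear (f m) by move=> b y z; rewrite /f scalerDl scalerA.
have rho_lin : linear (tensor_lift f) by apply: tensor_lift_linear.
have rhoX (T : {linear M -> M}) z : tensor_lift f (tmapl T z) = T (tensor_lift f z).
  move: z; apply: tensor_lift_unique => [||m a].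
  - exact: linear_compose (tmapl_linear _) rho_lin.
  - by apply: linear_compose rho_lin _ => b y z; rewrite linearP.
  - by rewrite tmaplE !tensor_liftE // /f linearZ.
have [|a k z as_ Wz||u u0 Wu] := Xirr _ (fun z => W (tensor_lift f z)).
- exact: subspace_preim rho_lin W_sub.
- by rewrite rhoX; apply: WX.
- exists (tens w (1 : K^o)); first by rewrite tensor_liftE // /f scale1r.
  apply: contraNneq w0 => /(congr1 (tensor_lift f)).
  by rewrite tensor_liftE // /f scale1r (linear_0 rho_lin) => ->.
move=> z; have := Wu z; rewrite tensor_liftE //; exact: subspaceZK.
Qed.

Lemma tensor_irreducible (V : lieModType (virasoro K)) :
  irreducible V -> (forall v : V, smooth v) -> irreducible (tensor M V).
Proof.
move=> [[v v0] V_irr] V_smooth; have [X [Xexp Xirr [phi [x phix]]]] := M_exp.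
split=> [|W [W_sub WL]].
  exists (tens x v); apply: contraNneq v0 => /(congr1 (contract phi)).
  by rewrite contractE phix scale1r (linear_0 (contract_linear _)) => ->.
apply: subspace_dichotomy => nzW.
(* The factor [V] contributes the empty list of bases, as each of its vectors is killed by [L_m] for
   large [m]. *)
have Zexp z : exponential_at s (fun m z => lie_act (virL K m%:Z) z)
    (fun a k => tmapl (X a k) : {linear tensor M V -> tensor M V}) z.
  have := @tensor_exponential_at K M V s [::] X (fun _ _ => idfun)
    (fun a k => tmapl (X a k) : {linear tensor M V -> tensor M V}).
  rewrite cats0; apply => // y; have [N yN] := V_smooth y.
  by exists N, 0%N => B' _; split=> // m /yN ->; rewrite big_nil.
have [|u u0 Wu] := Xirr V W W_sub _ nzW.
  move=> a k z as_ Wz.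
  apply: (exponential_at_stable k W_sub s_uniq s_neq0 (Zexp z) (r := 0%N)) => //.
  by move=> m _; apply: WL.
(* These [y] form a submodule because [tens m (g y)] is [g (tens m y)] minus [tens (g m) y]; it
   contains [u], so it is not zero. *)
have [|V0|VW] := V_irr (fun y => forall m, W (tens m y)).
- split.
    by apply: subspace_forall => m; apply: subspace_preim (tens_linearr m) W_sub.
  move=> g y _ Wy m; have Wgy : W (lie_act g (tens m y)) by apply: WL.
  rewrite [lie_act _ _]tensor_actE /tens_act in Wgy.
  have := subspaceB W_sub Wgy (Wy (lie_act g m)).
  by rewrite addrAC subrr add0r.
- by case/eqP: u0; apply: V0.
by apply: tensor_span => // m y; apply: VW.
Qed.

End Irreducibility.

Lemma tensor_seq_exponential_module (K : numFieldType) (I : Type)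
    (lam : I -> K) (M : I -> lieModType (virasoro K)) (r : seq I) :
  (forall i, exponential_module [:: lam i] (M i)) -> (0 < size r)%N ->
  uniq (map lam r) ->
  exponential_module (map lam r) (tensor_seq [seq M i | i <- r]).
Proof.
move=> M_exp; elim: r => // i [|j r] IHr _ lam_uniq; first exact: M_exp.
apply: (tensor_exponential_module (s := [:: lam i])) => //.
by apply: IHr => //; case/andP: lam_uniq.
Qed.

Theorem theorem4p4 (R : realType) (n : nat) (n_gt0 : (0 < n)%N)
    (lam al : 'I_n -> R[i]) (h : 'I_n -> {poly R[i]})
    (lam_neq0 : forall i, lam i != 0) (al_neq0 : forall i, al i != 0)
    (lam_inj : injective lam) (deg_h : forall i, size (h i) = 2%N)
    (V : lieModType (virasoro R[i])) (V_irr : irreducible V)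
    (V_locfin : exists RV : nat, forall k : int, RV%:Z <= k ->
      locally_finite (fun v : V => lie_act (virL R[i] k) v)) :
  let PhiT : lieModType (virasoro R[i]) :=
    bigtensor (fun i => Phi (al i) (h i) (lam_neq0 i)) in
  [/\ forall r : nat, irreducible_over (vir_gt r) PhiT,
      irreducible (tensor PhiT V)
    & irreducible PhiT].
Proof.
move=> PhiT.
have lam_uniq : uniq (map lam (enum 'I_n)) by rewrite map_inj_uniq // enum_uniq.
have lam_mem0 : 0 \notin map lam (enum 'I_n).
  by apply/mapP => -[i _ /esym/eqP]; apply/negP.
have PhiT_exp : exponential_module (map lam (enum 'I_n)) PhiT.
  apply: tensor_seq_exponential_module => //; last by rewrite size_enum_ord.
  by move=> i; apply: Phi_exponential_module.
have PhiT_irr r : irreducible_over (vir_gt r) PhiT.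
  exact: exponential_module_irreducible lam_uniq lam_mem0 PhiT_exp r.
have V_smooth := irreducible_smooth V_irr V_locfin.
split=> //.
  exact: tensor_irreducible lam_uniq lam_mem0 PhiT_exp _ V_irr V_smooth.
(* A submodule over the whole algebra is also one over [vir_gt 0]. *)
have [PhiT0 PhiTW] := PhiT_irr 0%N; split=> // W [W_sub WL].
by apply: PhiTW; split=> // x v _; apply: WL.
Qed.
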